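(* Let $Q_1,Q_2,Q_3$ be three non-zero irreducible monomial ideals of $S=K[x_1,\ldots,x_n]$ and $R=S/(Q_1\cap Q_2\cap Q_3)$. Then $\operatorname{sdepth}R\geq\operatorname{depth}R$, that is, Stanley's Conjecture holds for $R$.
   Context: $K$ is a field and $S=K[x_1,\ldots,x_n]$ with its standard $\mathbb{Z}^n$-grading (multigrading). A monomial ideal is irreducible if it is generated by powers of some of the variables. For a finitely generated multigraded $S$-module $M$, a homogeneous element $z\in M$ and $Z\subseteq\{x_1,\ldots,x_n\}$, let $zK[Z]\subset M$ be the $K$-subspace of all elements $zf$, $f\in K[Z]$; it is called a Stanley space of dimension $|Z|$ if it is a free $K[Z]$-module. A Stanley decomposition of $M$ is a presentation of the $K$-vector space $M$ as a finite direct sum of Stanley spaces $\mathcal{D}: M=\bigoplus_{i=1}^r z_iK[Z_i]$. Set $\operatorname{sdepth}\mathcal{D}=\min\{|Z_i|: i=1,\ldots,r\}$, and $\operatorname{sdepth}_S(M)=\operatorname{sdepth}(M)=\max\{\operatorname{sdepth}\mathcal{D}:\mathcal{D}\text{ a Stanley decomposition of }M\}$ (the Stanley depth of $M$). Stanley's Conjecture holds for $M$ if $\operatorname{sdepth}M\geq\operatorname{depth}M$, where depth is with respect to the maximal ideal $(x_1,\ldots,x_n)$. Here $R$ is regarded as an $S$-module. *)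

(* Defs.v *)
From HB Require Import structures.
From mathcomp Require Import all_boot all_order all_algebra.
From mathcomp Require Import generic_quotient ring_quotient.
From mathcomp Require Export mpoly.

Set Implicit Arguments.
Unset Strict Implicit.
Unset Printing Implicit Defensive.

Import GRing.Theory.
Local Open Scope ring_scope.
Local Open Scope quotient_scope.

Section IdealIntersection.
Variables (A : comNzRingType) (I J : idealr A).

Definition idealI : pred A := [predI (I : pred A) & (J : pred A)].

Lemma idealI_closed : idealr_closed idealI.
Proof.
split=> [||a u v]; rewrite !inE ?idealr0 ?idealr1 //.
by move=> /andP[uI uJ] /andP[vI vJ]; rewrite !rpredD ?idealMr.
Qed.

HB.instance Definition _ := isIdealr.Build A idealI idealI_closed.

End IdealIntersection.

(* The quotient ring A / I as a module over A. *)
Section QuotientModule.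
Variables (A : comNzRingType) (I : idealr A).

Definition quot_scale (a : A) (x : {ideal_quot I}) : {ideal_quot I} :=
  \pi_{ideal_quot I} a * x.

Lemma quot_scaleA a b x : quot_scale a (quot_scale b x) = quot_scale (a * b) x.
Proof. by rewrite /quot_scale mulrA rmorphM. Qed.

Lemma quot_scale1 : left_id 1 quot_scale.
Proof. by move=> x; rewrite /quot_scale rmorph1 mul1r. Qed.

Lemma quot_scaleDr : right_distributive quot_scale +%R.
Proof. by move=> a x y; rewrite /quot_scale mulrDr. Qed.

Lemma quot_scaleDl x : {morph quot_scale^~ x : a b / a + b}.
Proof. by move=> a b; rewrite /quot_scale rmorphD mulrDl. Qed.

HB.instance Definition _ := GRing.Zmodule_isLmodule.Build A {ideal_quot I}
  quot_scaleA quot_scale1 quot_scaleDr quot_scaleDl.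

End QuotientModule.

Definition is_max (P : nat -> Prop) (d : nat) : Prop :=
  P d /\ forall e : nat, P e -> (e <= d)%N.

(* x \in (f_1, ..., f_r) M; for M := A^o this is the ideal (f_1, ..., f_r). *)
Definition in_ideal_mul (A : comNzRingType) (M : lmodType A) (fs : seq A)
    (x : M) : Prop :=
  exists w : 'I_(size fs) -> M, x = \sum_(j < size fs) fs`_j *: w j.

(* f_i is a nonzerodivisor on M / (f_1, ..., f_(i-1)) M for all i, and
   M / (f_1, ..., f_r) M is nonzero. *)
Definition regular_seq (A : comNzRingType) (M : lmodType A) (fs : seq A) : Prop :=
  (forall (i : 'I_(size fs)) (x : M),
      in_ideal_mul (take i fs) (fs`_i *: x) -> in_ideal_mul (take i fs) x)
  /\ exists x : M, ~ in_ideal_mul fs x.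

Section StanleyDepth.
Variables (K : fieldType) (n : nat).
Local Notation S := {mpoly K[n]}.

Definition irreducible_monomial_ideal (Q : idealr S) : Prop :=
  exists (A : {set 'I_n}) (a : 'I_n -> nat),
    (forall i, i \in A -> (0 < a i)%N) /\
    forall p : S, p \in (Q : pred S) <->
      @in_ideal_mul S S^o [seq 'X_i ^+ a i | i <- enum A] p.

Definition nonzero_ideal (Q : idealr S) : Prop :=
  exists2 p : S, p \in (Q : pred S) & p != 0.

Definition in_maxideal (f : S) : Prop :=
  @in_ideal_mul S S^o [seq 'X_i | i <- enum 'I_n] f.

Definition is_depth (M : lmodType S) (d : nat) : Prop :=
  is_max (fun r => exists fs : seq S,
    [/\ forall f, f \in fs -> in_maxideal f, regular_seq M fs & size fs = r]) d.

Definition multidegree := {ffun 'I_n -> int}.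

Definition mpoly_homog (a : multidegree) (p : S) : Prop :=
  forall m : 'X_{1..n}, m \in msupp p -> [ffun i => (m i)%:Z] = a.

(* The homogeneous component of degree a of S / I, i.e. the image of S_a (for
   I a monomial ideal, these components form the Z^n-grading of S / I). *)
Definition quot_comp (I : idealr S) (a : multidegree) (x : {ideal_quot I}) : Prop :=
  exists2 p : S, mpoly_homog a p & x = \pi_{ideal_quot I} p.

(* f \in K[Z] *)
Definition mpoly_in (Z : {set 'I_n}) (f : S) : Prop :=
  forall m : 'X_{1..n}, m \in msupp f -> forall i, i \notin Z -> m i = 0%N.

(* In what follows, comp a is the component of M in degree a. *)
Section Module.
Variables (M : lmodType S) (comp : multidegree -> M -> Prop).

Definition homogeneous (z : M) : Prop := exists a, comp a z.

Definition in_span (z : M) (Z : {set 'I_n}) (x : M) : Prop :=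
  exists2 f : S, mpoly_in Z f & x = f *: z.

(* The last condition says that zK[Z] is free over K[Z], with basis z. *)
Definition stanley_space (z : M) (Z : {set 'I_n}) : Prop :=
  homogeneous z /\ forall f : S, mpoly_in Z f -> f *: z = 0 -> f = 0.

Record stanley_decomposition := StanleyDecomposition {
  sd_size : nat;
  sd_gen : 'I_sd_size -> M;
  sd_vars : 'I_sd_size -> {set 'I_n};
  sd_space : forall i, stanley_space (sd_gen i) (sd_vars i);
  sd_sum : forall x : M, exists2 y : 'I_sd_size -> M,
    forall i, in_span (sd_gen i) (sd_vars i) (y i) & x = \sum_i y i;
  sd_direct : forall y : 'I_sd_size -> M,
    (forall i, in_span (sd_gen i) (sd_vars i) (y i)) ->
    \sum_i y i = 0 -> forall i, y i = 0 }.

(* As |Z_i| <= n, the default n matters only for the empty decomposition, which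
   exists only when M = 0. *)
Definition sdepth_of (D : stanley_decomposition) : nat :=
  \big[minn/n]_(i < sd_size D) #|sd_vars i|.

Definition is_sdepth (s : nat) : Prop :=
  is_max (fun d => exists D : stanley_decomposition, sdepth_of D = d) s.

End Module.
End StanleyDepth.

(* Main.v *)
Require Import Defs.
From mathcomp Require Import all_boot all_algebra ring_quotient.
From mathcomp Require Import ring zify.
From Stdlib Require Import Classical IndefiniteDescription.

Set Implicit Arguments.
Unset Strict Implicit.
Unset Printing Implicit Defensive.

Import GRing.Theory.
Local Open Scope ring_scope.

(** A monomial lies outside the irreducible ideal Q_k exactly when its exponent
    vector lies in a box B_k, given by a strict upper bound q_k(i), possibly
    infinite, on each exponent.  Let F_k be the set of coordinates that B_k leaves
    unbounded.  The quotient R has the monomials of B_1 u B_2 u B_3 as a K-basis,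
    so a partition of this union into cells b + N^Z is a Stanley decomposition of
    R, and it is enough to find one in which every Z has at least d elements,
    where d is the depth.

    The depth is bounded above by Koszul cohomology.  If f is a nonzerodivisor of
    R in the ideal of the variables, a homotopy turns a nonzero class of degree t
    on R into a nonzero class of degree t - 1 on R / f R
    (nontrivial_class_regular); so a nonzero class of degree t for all the
    variables forces every regular sequence to have length at most t.  A nonzero
    class for a set U of variables yields one of degree t + n - |U| for all the
    variables (nontrivial_class_extend), hence d + |U| <= t + n
    (regular_seq_koszul_bound).  Multidegree by multidegree, Koszul cohomology is
    the reduced cohomology of a simplicial complex having at most one facet for
    each box, and three of its classes are used:
    - degree 0, a socle element at the corner of a box that lies in neither of the
      others: d <= |F_k|;
    - degree 1, a disconnected complex at the corner of B_k n B_l: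
      d <= |F_k n F_l| + 1;
    - degree 2, a hollow triangle at the corner of B_1 n B_2 n B_3:
      d <= |F_1 n F_2 n F_3| + 2.
    The last two come from the connecting map of the Mayer-Vietoris sequence
    0 -> S / (J n J') -> S / J + S / J' -> S / (J + J') -> 0, written on cochains
    (nontrivial_class_connecting).

    On the other side, a box minus another box is cut into boxes according to the
    first coordinate i, in a suitable order, whose exponent reaches the bound of
    the removed box: such a piece keeps i and all later coordinates as free as they
    were (slab_diff_partition).  A redundant box leaves a union of at most two.
    If B_1 n B_2 is contained in B_3, up to renumbering, the pieces are B_3,
    B_1 minus B_3 and B_2 minus B_3; these are disjoint, and the bounds of degree 0
    and 1 are what they need (union3_partition_middle).  Otherwise the triangle
    exists, and the pieces are B_1, B_2 minus B_1, and B_3 minus both others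
    (union3_partition_triangle). *)

(** * Koszul cochains over a commutative ring *)

Section Koszul.
Variable A : comNzRingType.
Implicit Types (xs gs : seq A) (s : seq bool) (N : A -> Prop).

Definition ideal_pred N :=
  [/\ N 0, forall u v, N u -> N v -> N (u + v) & forall a u, N u -> N (a * u)].

Lemma ideal_predN N u : ideal_pred N -> N u -> N (- u).
Proof. by case=> _ _ NM Nu; rewrite -mulN1r; apply: NM. Qed.

Lemma ideal_predB N u v : ideal_pred N -> N u -> N v -> N (u - v).
Proof. by move=> idN Nu Nv; have [_ ND _] := idN; apply: ND => //; apply: ideal_predN. Qed.

Lemma ideal_predB_trans N u v w :
  ideal_pred N -> N (u - v) -> N (v - w) -> N (u - w).
Proof.
by move=> [_ ND _] Nuv Nvw; rewrite -(subrKA v); apply: ND.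
Qed.

(** The Koszul differential.  A subset of xs is written as a bit sequence s, so
    that the complex of x :: xs is the mapping cone of x on the complex of xs and
    no sign depends on the position of an element in a set.  Only the values at
    sequences as long as xs matter. *)
Fixpoint koszul xs (c : seq bool -> A) s : A :=
  match xs, s with
  | _ :: xs', false :: s' => koszul xs' (fun r => c (false :: r)) s'
  | x :: xs', true :: s' =>
      x * c (false :: s') - koszul xs' (fun r => c (true :: r)) s'
  | _, _ => 0
  end.

Implicit Types c b : seq bool -> A.

Lemma eq_koszul xs c b s :
  (forall r, size r = size s -> c r = b r) -> koszul xs c s = koszul xs b s.
Proof.
elim: xs s c b => [|x xs IH] [|[] s] c b //= e.
  by rewrite e //; congr (_ - _); apply: IH => r er; rewrite e //= er.
by apply: IH => r er; rewrite e //= er.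
Qed.

Lemma koszul_linear xs a c b s :
  koszul xs (fun r => a * c r + b r) s = a * koszul xs c s + koszul xs b s.
Proof.
elim: xs s c b => [|x xs IH] [|[] s] c b //=; rewrite ?mulr0 ?addr0 //.
by rewrite IH; ring.
Qed.

Lemma koszul0 xs s : koszul xs (fun=> 0) s = 0.
Proof.
elim: xs s => [|x xs IH] [|[] s] //=.
by rewrite IH mulr0 subr0.
Qed.

Lemma koszulD xs c b s :
  koszul xs (fun r => c r + b r) s = koszul xs c s + koszul xs b s.
Proof.
rewrite -[X in X + _]mul1r -koszul_linear.
by apply: eq_koszul => r _; rewrite mul1r.
Qed.

Lemma koszulM xs a c s : koszul xs (fun r => a * c r) s = a * koszul xs c s.
Proof.
rewrite -[RHS]addr0 -[X in _ + X](koszul0 xs s) -koszul_linear.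
by apply: eq_koszul => r _; rewrite addr0.
Qed.

Lemma koszulB xs c b s :
  koszul xs (fun r => c r - b r) s = koszul xs c s - koszul xs b s.
Proof.
rewrite koszulD; congr (_ + _); rewrite -mulN1r -koszulM.
by apply: eq_koszul => r _; rewrite mulN1r.
Qed.

Lemma koszulN xs c s : koszul xs (fun r => - c r) s = - koszul xs c s.
Proof.
by rewrite -mulN1r -koszulM; apply: eq_koszul => r _; rewrite mulN1r.
Qed.

Lemma koszul_ideal N xs c s : ideal_pred N -> size s = size xs ->
  (forall r, size r = size xs -> N (c r)) -> N (koszul xs c s).
Proof.
move=> idN; have [N0 _ NM] := idN.
elim: xs s c => [|x xs IH] [|[] s] c //= [es] Nc.
  apply: ideal_predB => //; first by apply/NM/Nc; rewrite /= es.
  by apply: IH => // r er; apply: Nc; rewrite /= er.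
by apply: IH => // r er; apply: Nc; rewrite /= er.
Qed.

Lemma koszulK xs c s : koszul xs (koszul xs c) s = 0.
Proof.
elim: xs s c => [|x xs IH] [|[] s] c //=.
by rewrite (koszulB xs (fun r => x * c (false :: r))) koszulM IH subr0 subrr.
Qed.

(** Dropping the values of degree more than t - k.  The offset k lets the
    truncations before and after the differential share one t without a
    truncated subtraction. *)
Definition cutoff k t c s := if (count id s + k <= t)%N then c s else 0.

Lemma koszul_cutoff xs k t c s :
  koszul xs (cutoff k.+1 t c) s = cutoff k t (koszul xs c) s.
Proof.
rewrite /cutoff; elim: xs k s c => [|x xs IH] k [|[] s] c //=; rewrite ?if_same //.
rewrite (@eq_koszul _ _
  (fun r => if (count id r + k.+2 <= t)%N then c (true :: r) else 0)).
  rewrite IH add0n addnS add1n addSn.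
  by case: ifP => _; rewrite ?mulr0 ?subr0.
by move=> r _; rewrite add1n addSnnS.
Qed.

Lemma koszul_degree xs c t s : (forall r, (t < count id r)%N -> c r = 0) ->
  (t.+1 < count id s)%N -> koszul xs c s = 0.
Proof.
move=> ct ts; rewrite (@eq_koszul _ _ (cutoff 1 t.+1 c)) => [|r _].
  by rewrite koszul_cutoff /cutoff addn0 leqNgt ts.
by rewrite /cutoff addn1 ltnS; case: leqP => // /ct.
Qed.

Lemma koszul_nseq xs c k : koszul xs c (nseq k false) = 0.
Proof. by elim: xs k c => [|x xs IH] [|k] c /=. Qed.

(** Contraction by the linear form of the exterior algebra whose coefficients are
    gs, a homotopy between 0 and multiplication by the sum of the x_i g_i. *)
Fixpoint contraction gs c s : A :=
  match gs, s with
  | g :: gs', false :: s' =>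
      g * c (true :: s') + contraction gs' (fun r => c (false :: r)) s'
  | _ :: gs', true :: s' => - contraction gs' (fun r => c (true :: r)) s'
  | _, _ => 0
  end.

Lemma contractionMB gs a c b s :
  contraction gs (fun r => a * c r - b r) s = a * contraction gs c s - contraction gs b s.
Proof.
elim: gs s c b => [|g gs IH] [|[] s] c b //=; rewrite ?mulr0 ?subr0 // IH; ring.
Qed.

Lemma contraction_ideal N gs c s : ideal_pred N -> size s = size gs ->
  (forall r, size r = size gs -> N (c r)) -> N (contraction gs c s).
Proof.
move=> idN; have [N0 ND NM] := idN.
elim: gs s c => [|g gs IH] [|[] s] c //= [es] Nc.
  by rewrite -mulN1r; apply/NM/IH => // r er; apply: Nc; rewrite /= er.
apply: ND; first by apply/NM/Nc; rewrite /= es.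
by apply: IH => // r er; apply: Nc; rewrite /= er.
Qed.

Lemma contraction_degree gs c t s : (forall r, (t < count id r)%N -> c r = 0) ->
  (t <= count id s)%N -> contraction gs c s = 0.
Proof.
elim: gs t s c => [|g gs IH] t [|[] s] c //= ct ts.
  by rewrite (IH t.-1) ?oppr0 // => [r tr|]; [apply: ct => /= |]; lia.
by rewrite (IH t) // ?ct ?mulr0 ?addr0 // => r tr; apply: ct.
Qed.

Lemma koszul_homotopy xs gs c s : size gs = size xs -> size s = size xs ->
  koszul xs (contraction gs c) s + contraction gs (koszul xs c) s
  = (\sum_(i < size xs) xs`_i * gs`_i) * c s.
Proof.
elim: xs gs s c => [|x xs IH] [|g gs] [|v s] c //=.
  by rewrite big_ord0 mul0r addr0.
move=> [eg] [es]; rewrite big_ord_recl mulrDl /=.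
have IHc w := IH gs s (fun r => c (w :: r)) eg es.
case: v; rewrite -IHc.
  rewrite (contractionMB gs x (fun r => c (false :: r))) koszulN; ring.
rewrite koszulD koszulM; ring.
Qed.

(** The class is taken on A / N, through representatives in A.  Vanishing above
    degree t replaces being homogeneous of degree t: a contraction lowers this bound
    by one, and a cochain with a negative bound is 0. *)
Definition nontrivial_class N xs t := exists c : seq bool -> A,
  [/\ forall s, size s = size xs -> N (koszul xs c s),
      forall s, (t < count id s)%N -> c s = 0
    & ~ exists b : seq bool -> A,
          forall s, size s = size xs -> N (c s - koszul xs b s)].

(** If dc = 0 and h is the contraction for f, then f c = d (h c): so h c is a
    cocycle modulo f, one degree lower.  It is not a coboundary there, as
    h c = d b + f e would give f c = f d e, and then c = d e.  In degree 0 the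
    contraction vanishes, so that f c = 0 and c = 0. *)
Lemma nontrivial_class_regular N N' f xs t : ideal_pred N -> ideal_pred N' ->
  (forall p : A, N' p <-> exists q : A, N (p - f * q)) ->
  @in_ideal_mul A A^o xs f -> (forall p : A, N (f * p) -> N p) ->
  nontrivial_class N xs t -> (0 < t)%N /\ nontrivial_class N' xs t.-1.
Proof.
move=> idN idN' defN' [w def_f] regf [c [Zc ct nBc]].
have [N0 ND NM] := idN.
pose gs : seq A := [seq w i | i <- enum 'I_(size xs)].
have egs : size gs = size xs by rewrite size_map size_enum_ord.
have {}def_f : f = \sum_(i < size xs) xs`_i * gs`_i.
  rewrite def_f; apply: eq_bigr => i _; congr (_ * _).
  by rewrite (nth_map i) ?size_enum_ord // nth_ord_enum.
have fc s : size s = size xs -> N (f * c s - koszul xs (contraction gs c) s).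
  move=> es; rewrite def_f -koszul_homotopy // addrC addKr.
  by apply: contraction_ideal; rewrite ?egs.
have t_gt0 : (0 < t)%N.
  rewrite lt0n; apply/eqP => t0; apply: nBc; exists (fun=> 0) => s es.
  rewrite koszul0 subr0; apply: regf.
  have := fc s es; rewrite (@eq_koszul _ _ (fun=> 0)) ?koszul0 ?subr0 // => r _.
  by apply: (@contraction_degree _ _ 0%N) => // q; rewrite -t0; apply: ct.
split=> //; exists (contraction gs c); split=> [s es|s ts|[b Bb]].
- suff: N' (f * c s - koszul xs (contraction gs c) s - f * c s).
    by rewrite addrAC subrr sub0r => /(ideal_predN idN'); rewrite opprK.
  apply: ideal_predB => //; apply/defN'.
    by exists 0; rewrite mulr0 subr0; apply: fc.
  by exists (c s); rewrite subrr.
- have ts' : (t <= count id s)%N by lia.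
  exact: contraction_degree ct ts'.
have [e Be] : exists e : seq bool -> A, forall s, size s = size xs ->
    N (contraction gs c s - koszul xs b s - f * e s).
  apply: (functional_choice (fun s y =>
    size s = size xs -> N (contraction gs c s - koszul xs b s - f * y))) => s.
  have [es|nes] := eqVneq (size s) (size xs); last by exists 0 => /eqP; rewrite (negPf nes).
  by have /defN' [q Nq] := Bb s es; exists q.
apply: nBc; exists e => s es; apply: regf; rewrite mulrBr -koszulM.
apply: (ideal_predB_trans idN (fc s es)).
rewrite -[X in X - _]subr0 -(koszulK xs b s) -!koszulB.
by apply: koszul_ideal => // r er; apply: Be.
Qed.
End Koszul.

(** * Monomial ideals and additional variables *)

Section MonomialIdeals.
Variables (K : fieldType) (n : nat).
Local Notation S := {mpoly K[n]}.
Implicit Types (P : pred 'X_{1..n}) (p q : S) (m g : 'X_{1..n}) (vs : seq 'I_n).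

(** A monomial ideal is handled through the set P of the monomials outside it, its
    standard monomials; sums and intersections of ideals become intersections and
    unions of such sets. *)
Definition monomial_ideal P p : Prop := forall m, P m -> p@_m = 0.

Definition down_closed P := forall m m', P (m + m')%MM -> P m.

Lemma monomial_idealP P : down_closed P -> ideal_pred (monomial_ideal P).
Proof.
move=> dP; split=> [m _|u v Pu Pv m Pm|a u Pu m Pm]; first by rewrite mcoeff0.
  by rewrite mcoeffD Pu // Pv // addr0.
apply/eqP; rewrite mcoeff_eq0; apply/negP => /msuppM_le.
case/allpairsP => -[m1 m2] /= [_ m2u def_m].
have Pm2 : P m2 by apply: (dP m2 m1); rewrite addmC -def_m.
by move: m2u; rewrite mcoeff_msupp Pu ?eqxx.
Qed.

Lemma mcoeffXM i p m :
  ('X_i * p)@_m = if (0 < m i)%N then p@_(m - U_(i)) else 0.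
Proof.
case: ifP => [mi|/negbT mi].
  have def_m : m = (m - U_(i) + U_(i))%MM by rewrite submK // lep1mP -lt0n.
  by rewrite [in LHS]def_m addmC ['X_i * p]mulrC mcoeffMX.
apply/eqP; rewrite mcoeff_eq0; apply: contra mi => /msuppM_le.
case/allpairsP => -[m1 m2] /= [+ _ ->].
by rewrite msuppX inE => /eqP ->; rewrite mnmDE mnm1E eqxx.
Qed.

Lemma mcoeffXMD i p m : ('X_i * p)@_(m + U_(i)) = p@_m.
Proof. by rewrite addmC ['X_i * p]mulrC mcoeffMX. Qed.

Definition mrestrict P p := \sum_(m <- msupp p | P m) p@_m *: 'X_[m].

Lemma mcoeff_mrestrict P p m : (mrestrict P p)@_m = if P m then p@_m else 0.
Proof.
rewrite raddf_sum /=.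
under eq_bigr => k _ do rewrite mcoeffZ mcoeffX.
have [mp|mp] := boolP (m \in msupp p); last first.
  rewrite big1_seq => [|k /andP[_ kp]].
    by rewrite (memN_msupp_eq0 mp) if_same.
  by case: eqVneq kp mp => [->->|]; rewrite ?mulr0.
rewrite big_mkcond (bigD1_seq m) ?msupp_uniq //= eqxx mulr1.
rewrite big1 ?addr0 // => k /negPf nkm.
by rewrite nkm mulr0 if_same.
Qed.

Lemma mrestrictB P p q : mrestrict P (p - q) = mrestrict P p - mrestrict P q.
Proof.
by apply/mpolyP => m; rewrite !(mcoeffB, mcoeff_mrestrict); case: ifP; rewrite ?subr0.
Qed.

Definition vars vs : seq S := [seq 'X_i | i <- vs].

(** Multiplication by the other variables does not change the exponent of x_j, so
    truncation in x_j is a map of complexes. *)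
Lemma koszul_mrestrict j M vs (c : seq bool -> S) s : j \notin vs ->
  koszul (vars vs) (fun r => mrestrict (fun m => (m j < M)%N) (c r)) s
  = mrestrict (fun m => (m j < M)%N) (koszul (vars vs) c s).
Proof.
have r0 : mrestrict (fun m => (m j < M)%N) 0 = 0.
  by apply/mpolyP => m; rewrite mcoeff_mrestrict mcoeff0 if_same.
elim: vs s c => [|i vs IH] [|[] s] c /=; rewrite ?r0 // inE negb_or => /andP[ji jvs];
  last exact: IH.
rewrite mrestrictB -IH //; congr (_ - _); apply/mpolyP => m.
rewrite mcoeffXM !mcoeff_mrestrict mcoeffXM.
by case: ifP => //; rewrite ?if_same // mnmBE mnm1E (eq_sym i) (negPf ji) subn0.
Qed.

(** The Koszul cohomology H of the variables vs satisfies x_j H != H when H != 0;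
    a class z outside x_j H gives the nonzero class e_j z of degree t + 1 for the
    enlarged set of variables.  That x_j H = H is impossible is a graded Nakayama
    argument: c cannot agree with x_j^M z modulo coboundaries once M exceeds the
    exponents of x_j in c, as truncation in x_j would make c a coboundary. *)
Lemma nontrivial_class_extend P vs t j : down_closed P -> j \notin vs ->
  nontrivial_class (monomial_ideal P) (vars vs) t ->
  nontrivial_class (monomial_ideal P) (vars (j :: vs)) t.+1.
Proof.
move=> dP jis [c [Zc ct nBc]].
set N := monomial_ideal P; have idN : ideal_pred N by apply: monomial_idealP.
(* E e says that the class of c is divisible by x_j^e. *)
pose E e := exists b z : seq bool -> S,
  (forall s, size s = size (vars vs) -> N (koszul (vars vs) z s)) /\
  (forall s, size s = size (vars vs) ->
     N (c s - (koszul (vars vs) b s + 'X_j ^+ e * z s))).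
have E0 : E 0.
  exists (fun=> 0), c; split=> // s _.
  by rewrite koszul0 add0r expr0 mul1r subrr; case: idN.
have nE : exists M, ~ E M.
  pose M := (\max_(s : (size (vars vs)).-tuple bool) msize (c s))%N.
  exists M => -[b [z [_ defc]]]; apply: nBc.
  exists (fun r => mrestrict (fun m => (m j < M)%N) (b r)) => s es m Pm.
  rewrite koszul_mrestrict // mcoeffB mcoeff_mrestrict; case: ifP => mj.
    have := defc s es m Pm; rewrite mcoeffB mcoeffD.
    suff -> : ('X_j ^+ M * z s)@_m = 0 by rewrite addr0.
    elim: (M) m mj {Pm} => [//|e IHe] m mj; rewrite exprS -mulrA mcoeffXM.
    case: ifP => // mj0; apply: IHe; rewrite mnmBE mnm1E eqxx; lia.
  rewrite subr0; apply: memN_msupp_eq0; apply: contraFN mj => mc.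
  apply: leq_trans (leq_bigmax (Tuple (introT eqP es))) => /=.
  apply: leq_trans (msize_mdeg_lt mc); rewrite ltnS mdegE.
  by rewrite (bigD1 j) //= leq_addr.
have [e [[b [z [Zz defc]]] nEe]] : exists e, E e /\ ~ E e.+1.
  have [M nEM] := nE; apply: NNPP => nex; case: nEM.
  by elim: M => // e Ee; apply: NNPP => nEe; apply: nex; exists e.
(* Cutting b and z down to their degrees makes e_j z vanish above degree t + 1. *)
have defc' s : size s = size (vars vs) ->
    N (c s - (koszul (vars vs) (cutoff 1 t b) s + 'X_j ^+ e * cutoff 0 t z s)).
  move=> es; rewrite koszul_cutoff /cutoff addn0; case: ifP => [_|/negbT ts].
    exact: defc.
  by rewrite mulr0 addr0 subr0 ct ?ltnNge //; case: idN.
pose z' := cutoff 0 t z.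
have Zz' s : size s = size (vars vs) -> N (koszul (vars vs) z' s).
  move=> es; have -> : koszul (vars vs) z' s = koszul (vars vs) (cutoff 1 t.+1 z) s.
    by apply: eq_koszul => r _; rewrite /z' /cutoff addn0 addn1 ltnS.
  rewrite koszul_cutoff /cutoff; case: ifP => _; first exact: Zz.
  by case: idN.
(* This cochain is e_j z'. *)
exists (fun s => if s is true :: s' then z' s' else 0); split=> [[|[] s] //= [es]|s|[b' Bb']].
- by rewrite mulr0 sub0r; exact: (ideal_predN idN (Zz' s es)).
- by have [N0 _ _] := idN; apply: (koszul_ideal idN es).
- by case: s => [|[] s] //=; rewrite add1n ltnS /z' /cutoff addn0 ltnNge; case: ifP.
pose beta r := b' (false :: r); pose beta' r := b' (true :: r).
have Zbeta s : size s = size (vars vs) -> N (koszul (vars vs) beta s).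
  move=> es; have := Bb' (false :: s); rewrite /= es => /(_ erefl).
  by rewrite sub0r => /(ideal_predN idN); rewrite opprK.
apply: nEe; exists (fun r => cutoff 1 t b r - 'X_j ^+ e * beta' r), beta; split=> // s es.
apply: (ideal_predB_trans idN (defc' s es)).
rewrite koszulB koszulM exprSr.
have [_ _ NM] := idN.
have := Bb' (true :: s); rewrite /= es => /(_ erefl) /(NM ('X_j ^+ e)).
rewrite -/(beta s) -/beta' -/(z' s); congr N; rewrite /beta; ring.
Qed.

Lemma nontrivial_class_add_vars P vs ws t : down_closed P -> uniq (ws ++ vs) ->
  nontrivial_class (monomial_ideal P) (vars vs) t ->
  nontrivial_class (monomial_ideal P) (vars (ws ++ vs)) (size ws + t).
Proof.
move=> dP; elim: ws => //= j ws IH /andP[jn uj] ntc.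
exact: nontrivial_class_extend (IH uj ntc).
Qed.

End MonomialIdeals.

(** * Explicit Koszul classes of monomial quotients *)

Section KoszulClasses.
Variables (K : fieldType) (n : nat).
Local Notation S := {mpoly K[n]}.
Implicit Types (P Q : pred 'X_{1..n}) (p : S) (m g : 'X_{1..n}) (vs : seq 'I_n).
Implicit Types (b c : seq bool -> S).

Lemma addmAC m1 m2 m3 : (m1 + m2 + m3 = m1 + m3 + m2 :> 'X_{1..n})%MM.
Proof. by rewrite -!addmA (addmC m2). Qed.

Lemma monomial_idealX P g : ~~ P g -> monomial_ideal P ('X_[g] : S).
Proof.
by move=> Pg m Pm; rewrite mcoeffX; case: eqVneq Pm Pg => // -> ->.
Qed.

(** The bit sequence of the singleton {i}. *)
Definition one_hot vs i := [seq k == i | k <- vs].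

Lemma size_one_hot vs i : size (one_hot vs i) = size (vars K vs).
Proof. by rewrite !size_map. Qed.

Lemma one_hot_notin vs i : i \notin vs -> one_hot vs i = nseq (size vs) false.
Proof.
elim: vs => //= k vs IH; rewrite inE negb_or => /andP[ik iv].
by rewrite -IH // eq_sym (negPf ik).
Qed.

Lemma koszul_one_hot vs b i : uniq vs -> i \in vs ->
  koszul (vars K vs) b (one_hot vs i) = 'X_i * b (nseq (size vs) false).
Proof.
elim: vs b => //= k vs IH b /andP[kv uv]; rewrite inE eq_sym.
have [->|_] := eqVneq i k => /= iv; last exact: IH.
by rewrite one_hot_notin // koszul_nseq subr0.
Qed.

(** A 1-cocycle is constant along an edge {i, j} of the simplicial complex attached
    to the multidegree of g: the value at {i, j} of the coboundary of b has, up to sign,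
    the difference of the two coefficients as its coefficient at x_i x_j g. *)
Lemma koszul_cocycle_coeff P vs b g i j : uniq vs -> i \in vs -> j \in vs -> i != j ->
  P (g + U_(i) + U_(j))%MM ->
  (forall s, size s = size (vars K vs) -> monomial_ideal P (koszul (vars K vs) b s)) ->
  (b (one_hot vs i))@_(g + U_(i)) = (b (one_hot vs j))@_(g + U_(j)).
Proof.
elim: vs b i j => //= k vs IH b i j /andP[kv uv].
wlog def_i: i j / i = k => [hwlog iv jv ij Pij Zb|].
  have [ik|/eqP nik] := i =P k; first exact: hwlog.
  have [jk|/eqP njk] := j =P k.
    by apply/esym/hwlog => //; rewrite 1?eq_sym // addmAC.
  move: iv jv; rewrite !inE (negPf nik) (negPf njk) /= => iv jv.
  rewrite (eq_sym k i) (eq_sym k j) (negPf nik) (negPf njk).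
  by apply: (IH (fun r => b (false :: r))) => // s es; apply: (Zb (false :: s)); rewrite /= es.
rewrite {}def_i !inE eqxx (eq_sym k) => _ /predU1P[->|jv nkj Pkj Zb]; first by rewrite eqxx.
rewrite (negPf nkj).
have := Zb (true :: one_hot vs j); rewrite /= size_one_hot => /(_ erefl _ Pkj).
rewrite koszul_one_hot // mcoeffB mcoeffXMD [X in 'X_k * X]/=.
rewrite addmAC mcoeffXMD (one_hot_notin kv) => /eqP.
by rewrite subr_eq0 => /eqP ->.
Qed.

Definition point_cochain p (s : seq bool) : S := if has id s then 0 else p.

Lemma koszul_point N vs p s : ideal_pred N ->
  (forall i, i \in vs -> N ('X_i * p)) -> N (koszul (vars K vs) (point_cochain p) s).
Proof.
move=> idN; have [N0 _ NM] := idN.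
elim: vs s => [|i vs IH] [|[] s] //= Np; last first.
  by apply: IH => j jv; apply: Np; rewrite inE jv orbT.
rewrite {2}/point_cochain /= koszul0 subr0 /point_cochain /=.
by case: ifP => _; [rewrite mulr0 | apply: Np; rewrite inE eqxx].
Qed.

Lemma point_cochain_degree p s : (0 < count id s)%N -> point_cochain p s = 0.
Proof. by rewrite /point_cochain has_count => ->. Qed.

Lemma point_cochain_nseq p k : point_cochain p (nseq k false) = p.
Proof. by rewrite /point_cochain has_nseq andbF. Qed.

(** The monomial of g is killed by the variables of vs, so it is a cocycle of
    degree 0, and the only coboundary in that degree is 0. *)
Lemma nontrivial_class_socle P vs g : down_closed P -> P g ->
  (forall i, i \in vs -> ~~ P (g + U_(i))%MM) ->
  nontrivial_class (monomial_ideal (K := K) P) (vars K vs) 0.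
Proof.
move=> dP Pg gP; exists (point_cochain 'X_[g]); split.
- move=> s _; apply: koszul_point; first exact: monomial_idealP.
  by move=> i iv; rewrite -mpolyXD addmC; apply: monomial_idealX; apply: gP.
- exact: point_cochain_degree.
case=> b /(_ (nseq (size vs) false)); rewrite size_nseq size_map => /(_ erefl g Pg).
rewrite point_cochain_nseq koszul_nseq subr0 mcoeffX eqxx => /eqP.
by rewrite oner_eq0.
Qed.

(** The connecting map of the Mayer-Vietoris sequence: for c a cocycle modulo
    J + J', with J and J' the ideals of standard monomials P and P', the coboundary
    of c splits as a sum over J and J', and its part in J, made of the monomials
    outside P, is a cocycle modulo J n J'. *)
Definition connecting P vs c s := mrestrict (predC P) (koszul (vars K vs) c s).

Lemma connecting_sub P vs c s : monomial_ideal P (connecting P vs c s).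
Proof. by move=> m Pm; rewrite mcoeff_mrestrict /= Pm. Qed.

Lemma connecting_congr P P' vs c s :
  monomial_ideal (predI P P') (koszul (vars K vs) c s) ->
  monomial_ideal P' (koszul (vars K vs) c s - connecting P vs c s).
Proof.
move=> Nc m Pm; rewrite mcoeffB mcoeff_mrestrict /=.
by case: ifP => [_|/negbFE P'm]; rewrite ?subrr // subr0 Nc //= P'm Pm.
Qed.

(** The cochain is 0 modulo J and d c modulo J', two cocycles. *)
Lemma connecting_cocycle P P' vs c : down_closed P -> down_closed P' ->
  (forall s, size s = size (vars K vs) ->
     monomial_ideal (predI P P') (koszul (vars K vs) c s)) ->
  forall s, size s = size (vars K vs) ->
    monomial_ideal (predU P P') (koszul (vars K vs) (connecting P vs c) s).
Proof.
move=> /(monomial_idealP K) idP /(monomial_idealP K) idP' Zc s es m.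
case/orP => [Pm|P'm].
  by apply: (koszul_ideal idP es _ m Pm) => r er; apply: connecting_sub.
have -> : koszul (vars K vs) (connecting P vs c) s =
    - koszul (vars K vs) (fun r => koszul (vars K vs) c r - connecting P vs c r) s.
  by rewrite koszulB koszulK sub0r opprK.
rewrite mcoeffN.
rewrite (koszul_ideal idP' es _ m P'm) ?oppr0 // => r er.
by apply: connecting_congr; apply: Zc.
Qed.

(** Exactness: the image of c vanishes only if c is a cocycle modulo J plus a
    cocycle modulo J'.  The two cochains are b and c - b. *)
Lemma nontrivial_class_connecting P P' Q vs t c :
  down_closed P -> down_closed P' -> Q =1 predU P P' ->
  (forall s, (t < count id s)%N -> c s = 0) ->
  (forall s, size s = size (vars K vs) ->
     monomial_ideal (predI P P') (koszul (vars K vs) c s)) ->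
  ~ (exists b, (forall s, size s = size (vars K vs) ->
       monomial_ideal P (koszul (vars K vs) b s)) /\
     (forall s, size s = size (vars K vs) ->
       monomial_ideal P' (koszul (vars K vs) (fun r => c r - b r) s))) ->
  nontrivial_class (monomial_ideal (K := K) Q) (vars K vs) t.+1.
Proof.
move=> dP dP' defQ ct Zc nsplit; exists (connecting P vs c); split.
- move=> s es m; rewrite defQ => Qm.
  exact: (connecting_cocycle dP dP' Zc es).
- move=> s ts; rewrite /connecting (koszul_degree _ ct ts).
  by apply/mpolyP => m; rewrite mcoeff_mrestrict mcoeff0 if_same.
case=> b Bb; apply: nsplit; exists b; split=> s es m Pm.
  have := Bb s es m; rewrite defQ /= Pm => /(_ erefl).
  by rewrite mcoeffB connecting_sub // sub0r => /eqP; rewrite oppr_eq0 => /eqP.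
have := Bb s es m; rewrite defQ /= Pm orbT => /(_ erefl) dm.
have := connecting_congr (Zc s es) Pm.
by rewrite koszulB !mcoeffB -[X in _ -> X = _](subrKA (connecting P vs c s)@_m) => ->;
  rewrite add0r -mcoeffB.
Qed.

(** No vertex of the simplicial complex attached to g belongs to both parts P and
    P', and each part has a vertex.  The class is the connecting image of the
    monomial g, a cocycle of degree 0 modulo J + J'; if it split as b + (g - b),
    the coefficient of g would be 0 in b because of i, and 1 because of j. *)
Lemma nontrivial_class_disconnected P P' Q vs g i j : uniq vs ->
  down_closed P -> down_closed P' -> Q =1 predU P P' ->
  (forall k, k \in vs -> ~~ (P (g + U_(k))%MM && P' (g + U_(k))%MM)) ->
  i \in vs -> P (g + U_(i))%MM -> j \in vs -> P' (g + U_(j))%MM ->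
  nontrivial_class (monomial_ideal (K := K) Q) (vars K vs) 1.
Proof.
move=> uv dP dP' defQ sep iv Pi jv Pj.
have dPP : down_closed (predI P P').
  by move=> m m' /andP[/dP Pm /dP' Pm']; rewrite /= Pm.
apply: (nontrivial_class_connecting dP dP' defQ (@point_cochain_degree 'X_[g])).
  move=> s _; apply: koszul_point; first exact: monomial_idealP.
  by move=> k kv; rewrite -mpolyXD addmC; apply: monomial_idealX; apply: sep.
case=> b [Zb Zc].
have := Zb _ (size_one_hot vs i) _ Pi; rewrite koszul_one_hot // mcoeffXMD => b0.
have := Zc _ (size_one_hot vs j) _ Pj; rewrite koszul_one_hot // mcoeffXMD.
rewrite mcoeffB b0 point_cochain_nseq mcoeffX eqxx subr0 => /eqP.
by rewrite oner_eq0.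
Qed.

(** Three facets that meet pairwise and have no common vertex.  Modulo
    (J_1 n J_2) + J_3, the facets are those of P_1 n P_3 and of P_2 n P_3, which are
    disjoint: the degree 1 class separating them is the cocycle to which the
    connecting map is applied.  If it split as b + (c - b), then b would be
    constant along {i, j} and {i, k}, and c - b along {j, k}, whereas c takes the
    values 0 at j and 1 at k. *)
Lemma nontrivial_class_triangle P1 P2 P3 Q vs g i j k : uniq vs ->
  down_closed P1 -> down_closed P2 -> down_closed P3 ->
  Q =1 predU (predU P1 P2) P3 ->
  (forall l, l \in vs ->
     ~~ [&& P1 (g + U_(l))%MM, P2 (g + U_(l))%MM & P3 (g + U_(l))%MM]) ->
  i \in vs -> j \in vs -> k \in vs ->
  P1 (g + U_(i) + U_(j))%MM -> P2 (g + U_(i) + U_(k))%MM ->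
  P3 (g + U_(j) + U_(k))%MM ->
  nontrivial_class (monomial_ideal (K := K) Q) (vars K vs) 2.
Proof.
move=> uv d1 d2 d3 defQ sep iv jv kv P1ij P2ik P3jk.
have P1i := d1 _ _ P1ij; have P1j : P1 (g + U_(j))%MM by apply: (d1 _ U_(i)%MM); rewrite addmAC.
have P2i := d2 _ _ P2ik; have P2k : P2 (g + U_(k))%MM by apply: (d2 _ U_(i)%MM); rewrite addmAC.
have P3j := d3 _ _ P3jk; have P3k : P3 (g + U_(k))%MM by apply: (d3 _ U_(j)%MM); rewrite addmAC.
have sepi := sep i iv; have sepj := sep j jv; have sepk := sep k kv.
have ij : i != j by apply: contraNneq sepj => eij; rewrite P1j P3j -eij P2i.
have ik : i != k by apply: contraNneq sepk => eik; rewrite P2k P3k -eik P1i.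
have jk : j != k by apply: contraNneq sepk => ejk; rewrite P2k P3k -ejk P1j.
have dI P P' : down_closed P -> down_closed P' -> down_closed (predI P P').
  by move=> dP dP' m m' /andP[/dP Pm /dP' Pm']; rewrite /= Pm.
have dU P P' : down_closed P -> down_closed P' -> down_closed (predU P P').
  by move=> dP dP' m m' /orP[/dP Pm|/dP' Pm]; rewrite /= Pm ?orbT.
pose c := connecting (predI P1 P3) vs (point_cochain 'X_[g]).
have c_one_hot l : l \in vs -> (c (one_hot vs l))@_(g + U_(l)) =
    (~~ (P1 (g + U_(l)) && P3 (g + U_(l))))%MM%:R.
  move=> lv; rewrite mcoeff_mrestrict koszul_one_hot // mcoeffXMD.
  by rewrite point_cochain_nseq mcoeffX eqxx /=; case: (_ && _).
apply: (@nontrivial_class_connecting (predU P1 P2) P3 _ _ _ c (dU _ _ d1 d2) d3 defQ).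
- move=> s ts; rewrite /c /connecting (koszul_degree _ (@point_cochain_degree 'X_[g]) ts).
  by apply/mpolyP => m; rewrite mcoeff_mrestrict mcoeff0 if_same.
- move=> s es m Pm; apply: (connecting_cocycle (dI _ _ d1 d3) (dI _ _ d2 d3) _ es).
    move=> r _; apply: koszul_point; first apply: monomial_idealP.
      exact: (dI _ _ (dI _ _ d1 d3) (dI _ _ d2 d3)).
    move=> l lv; rewrite -mpolyXD addmC; apply: monomial_idealX.
    by apply: contra (sep l lv) => /= /andP[/andP[-> ->] /andP[-> _]].
  by move: Pm => /= /andP[/orP[] -> ->]; rewrite ?orbT.
case=> b [Zb Zc].
have Zb1 s : size s = size (vars K vs) -> monomial_ideal P1 (koszul (vars K vs) b s).
  by move=> es m P1m; apply: Zb => //=; rewrite P1m.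
have Zb2 s : size s = size (vars K vs) -> monomial_ideal P2 (koszul (vars K vs) b s).
  by move=> es m P2m; apply: Zb => //=; rewrite P2m orbT.
have e1 := koszul_cocycle_coeff uv iv jv ij P1ij Zb1.
have e2 := koszul_cocycle_coeff uv iv kv ik P2ik Zb2.
have := koszul_cocycle_coeff uv jv kv jk P3jk Zc.
rewrite !mcoeffB -e1 -e2 !c_one_hot // P1j P3j P3k andbT /=.
have -> /= : P1 (g + U_(k))%MM = false by apply: contraNF sepk => ->; rewrite P2k.
by move=> /addIr /eqP; rewrite eq_sym oner_eq0.
Qed.

End KoszulClasses.

(** * Boxes of exponents *)

Section Boxes.
Variable n : nat.
Implicit Types (q : 'I_n -> option nat) (m g : 'X_{1..n}) (i j k : 'I_n) (M : nat).

Definition below (h : option nat) (e : nat) := if h is Some h' then (e < h')%N else true.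

Definition box q : pred 'X_{1..n} := fun m => [forall i, below (q i) (m i)].

Lemma boxP q m : reflect (forall i, below (q i) (m i)) (box q m).
Proof. exact: forallP. Qed.

(** The variables outside the associated prime of the irreducible ideal. *)
Definition free_vars q := [set i | q i == None].

Definition positive q := forall i, q i != Some 0%N.

(** Inclusion of boxes, which is decided on their bounds. *)
Definition box_le q q' :=
  [forall i, if q' i is Some h' then if q i is Some h then (h <= h')%N else false else true].

Definition cap q q' i :=
  match q i, q' i with
  | Some h, Some h' => Some (minn h h')
  | Some h, None => Some h
  | None, h => h
  end.

(** The largest exponent vector of the box, with M in place of an infinite exponent.
    M large takes the corner out of every box that is bounded where this one is
    not, which amounts to inverting the free variables. *)
Definition corner M q := [multinom (if q i is Some h then h.-1 else M) | i < n].

Lemma box_down_closed q : down_closed (box q).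
Proof.
move=> m m' /boxP bm; apply/boxP => i; move: (bm i); rewrite /below mnmDE.
by case: (q i) => // h; apply: leq_ltn_trans (leq_addr _ _).
Qed.

Lemma box_cap q q' m : box (cap q q') m = box q m && box q' m.
Proof.
apply/boxP/andP => [bm|[/boxP bm /boxP bm'] i].
  by split; apply/boxP => i; move: (bm i); rewrite /below /cap;
    case: (q i) => [h|]; case: (q' i) => [h'|] //; rewrite leq_min => /andP[].
move: (bm i) (bm' i); rewrite /below /cap.
by case: (q i) => [h|]; case: (q' i) => [h'|] //; rewrite leq_min => -> ->.
Qed.

Lemma free_cap q q' : free_vars (cap q q') = free_vars q :&: free_vars q'.
Proof.
by apply/setP => i; rewrite !inE /cap; case: (q i) => [h|]; case: (q' i).
Qed.

Lemma positive_cap q q' : positive q -> positive q' -> positive (cap q q').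
Proof.
move=> pq pq' i; move: (pq i) (pq' i); rewrite /cap.
by case: (q i) => [[|h]|]; case: (q' i) => [[|h']|] //; rewrite minnSS.
Qed.

Lemma box_le_sub q q' m : box_le q q' -> box q m -> box q' m.
Proof.
move=> /forallP qq' /boxP bm; apply/boxP => i; move: (qq' i) (bm i); rewrite /below.
by case: (q' i) => // h'; case: (q i) => // h hh' /leq_trans; apply.
Qed.

Lemma box_corner M q : positive q -> box q (corner M q).
Proof.
by move=> pq; apply/boxP => i; rewrite mnmE; move: (pq i); case: (q i) => [[|h]|] //=.
Qed.

Definition bounded_by M q := forall i h, q i = Some h -> (h <= M)%N.

Lemma corner_box M q q' : positive q -> bounded_by M q' ->
  box q' (corner M q) -> box_le q q'.
Proof.
move=> pq q'M /boxP bm; apply/forallP => i; move: (bm i) (q'M i) (pq i); rewrite mnmE.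
case: (q' i) => //= h'; case: (q i) => [[|h]|] //= + /(_ h' erefl); lia.
Qed.

Lemma corner_exit M q i : i \notin free_vars q -> ~~ box q (corner M q + U_(i))%MM.
Proof.
rewrite inE => qi; apply/boxP => /(_ i); rewrite mnmDE mnmE mnm1E eqxx.
by case: (q i) qi => //= h _; lia.
Qed.

Lemma box_add_free q m i : i \in free_vars q -> box q m -> box q (m + U_(i))%MM.
Proof.
rewrite inE => /eqP qi /boxP bm; apply/boxP => j; rewrite mnmDE mnm1E.
have [<-|_] := eqVneq i j; first by rewrite qi.
by rewrite addn0.
Qed.

Lemma box_add_distinct q m i j : i != j ->
  box q (m + U_(i))%MM -> box q (m + U_(j))%MM -> box q (m + U_(i) + U_(j))%MM.
Proof.
move=> nij /boxP bi /boxP bj; apply/boxP => k; move: (bi k) (bj k).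
rewrite !mnmDE !mnm1E; have [<-|_] := eqVneq i k; last by rewrite addn0.
by rewrite eq_sym (negPf nij) !addn0.
Qed.

(** Where q exceeds q', the corner of the intersection can grow inside the first
    box. *)
Lemma corner_cap_exit M q q' : positive q -> positive q' -> ~~ box_le q q' ->
  exists2 i, i \notin free_vars q' & box q (corner M (cap q q') + U_(i))%MM.
Proof.
move=> pq pq'; rewrite negb_forall => /existsP[i qi]; exists i.
  by rewrite inE; case: (q' i) qi.
have /boxP bc := box_corner M (positive_cap pq pq').
apply/boxP => j; move: (bc j); rewrite mnmDE !mnmE.
have [<-|_] := eqVneq i j; last first.
  by rewrite addn0 /cap; case: (q j) => //= h; case: (q' j) => //= h'; lia.
move: qi (pq i) (pq' i); rewrite /cap.
case: (q' i) => [[|h']|] //=; case: (q i) => [[|h]|] //=; lia.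
Qed.

Lemma exists_bound q : exists M, bounded_by M q.
Proof.
exists (\max_i odflt 0 (q i))%N => i h qi.
by apply: leq_trans (leq_bigmax i); rewrite qi.
Qed.

Lemma bounded_byS M M' q : (M <= M')%N -> bounded_by M q -> bounded_by M' q.
Proof. by move=> MM' qM i h /qM /leq_trans; apply. Qed.

End Boxes.

(** * Depth bounds given by the Koszul classes *)

Section DepthBounds.
Variables (K : fieldType) (n d : nat) (Q : pred 'X_{1..n}).
Implicit Types (q : 'I_n -> option nat) (P : pred 'X_{1..n}) (M : nat).

(** What a regular sequence of length d in the ideal of the variables entails
    (regular_seq_koszul_bound); on the partition side d is known through it
    alone. *)
Definition koszul_bound := forall vs t, uniq vs ->
  nontrivial_class (monomial_ideal (K := K) Q) (vars K vs) t -> (d + size vs <= t + n)%N.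

Hypothesis dQ : koszul_bound.

Lemma koszul_bound_set (F : {set 'I_n}) t :
  nontrivial_class (monomial_ideal (K := K) Q) (vars K (enum (~: F))) t ->
  (d <= t + #|F|)%N.
Proof.
move=> /(dQ (enum_uniq _)); rewrite -cardE.
by rewrite -[X in (_ <= _ + X)%N -> _]card_ord -(cardsC F) addnA leq_add2r.
Qed.

(** The corner of the box is a socle element for the variables that are not
    free. *)
Lemma koszul_bound_free q P M : positive q -> down_closed P -> Q =1 predU (box q) P ->
  ~~ P (corner M q) -> (d <= #|free_vars q|)%N.
Proof.
move=> pq dP defQ Pq; apply: (@koszul_bound_set _ 0).
apply: (@nontrivial_class_socle _ _ _ _ (corner M q)).
- by move=> m m'; rewrite !defQ => /orP[/box_down_closed|/dP] /= ->; rewrite ?orbT.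
- by rewrite defQ /= box_corner.
move=> i; rewrite mem_enum inE => qi; rewrite defQ /= negb_or corner_exit //.
by apply: contra Pq => /dP.
Qed.

(** When neither set of free variables contains the other, a variable that is free
    in one box only gives a vertex on each side, so the complex at the corner of
    the intersection is disconnected.  Otherwise the intersection is one of the two
    sets, and the bound is among the hypotheses.  The second part P may be larger
    than the box q2, which lets it absorb a third box. *)
Lemma koszul_bound_cap q1 q2 P M : positive q1 -> positive q2 -> down_closed P ->
  Q =1 predU (box q1) P -> subpred (box q2) P ->
  (forall i, i \notin free_vars (cap q1 q2) ->
     ~~ (box q1 (corner M (cap q1 q2) + U_(i))%MM && P (corner M (cap q1 q2) + U_(i))%MM)) ->
  (d <= #|free_vars q1|)%N -> (d <= #|free_vars q2|)%N ->
  (d <= #|free_vars q1 :&: free_vars q2|.+1)%N.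
Proof.
move=> p1 p2 dP defQ q2P sep d1 d2.
have [/setIidPl ->|/subsetPn[i i1 i2]] := boolP (free_vars q1 \subset free_vars q2).
  exact: leq_trans d1 _.
have [/setIidPr ->|/subsetPn[j j2 j1]] := boolP (free_vars q2 \subset free_vars q1).
  exact: leq_trans d2 _.
have := box_corner M (positive_cap p1 p2); rewrite box_cap => /andP[b1 b2].
rewrite -add1n -free_cap; apply: koszul_bound_set.
apply: (@nontrivial_class_disconnected _ _ (box q1) P _ _ (corner M (cap q1 q2)) i j).
- exact: enum_uniq.
- exact: box_down_closed.
- exact: dP.
- exact: defQ.
- by move=> k; rewrite mem_enum inE; apply: sep.
- by rewrite mem_enum inE free_cap inE (negPf i2) andbF.
- exact: box_add_free.
- by rewrite mem_enum inE free_cap inE (negPf j1).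
by apply/q2P/box_add_free.
Qed.

(** Each failing inclusion gives a vertex common to two facets at the corner of the
    triple intersection; none is common to all three, as that corner cannot grow
    in a bounded coordinate. *)
Lemma koszul_bound_triangle q1 q2 q3 : positive q1 -> positive q2 -> positive q3 ->
  Q =1 predU (predU (box q1) (box q2)) (box q3) ->
  ~~ box_le (cap q1 q2) q3 -> ~~ box_le (cap q1 q3) q2 -> ~~ box_le (cap q2 q3) q1 ->
  (d <= #|free_vars q1 :&: free_vars q2 :&: free_vars q3|.+2)%N.
Proof.
move=> p1 p2 p3 defQ n12 n13 n23.
pose g := corner 0 (cap (cap q1 q2) q3).
have g13 : g = corner 0 (cap (cap q1 q3) q2).
  apply/mnmP => i; rewrite !mnmE /cap.
  by case: (q1 i) (q2 i) (q3 i) => [h1|] [h2|] [h3|] //; lia.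
have g23 : g = corner 0 (cap (cap q2 q3) q1).
  apply/mnmP => i; rewrite !mnmE /cap.
  by case: (q1 i) (q2 i) (q3 i) => [h1|] [h2|] [h3|] //; lia.
have [i i3] := corner_cap_exit 0 (positive_cap p1 p2) p3 n12.
rewrite -/g box_cap => /andP[i1 i2].
have [j j2] := corner_cap_exit 0 (positive_cap p1 p3) p2 n13.
rewrite -g13 box_cap => /andP[j1 j3].
have [k k1] := corner_cap_exit 0 (positive_cap p2 p3) p1 n23.
rewrite -g23 box_cap => /andP[k2 k3].
pose F := free_vars q1 :&: free_vars q2 :&: free_vars q3.
have sep l : l \notin F -> ~~ [&& box q1 (g + U_(l))%MM, box q2 (g + U_(l))%MM
                               & box q3 (g + U_(l))%MM].
  rewrite /F -!free_cap => /(corner_exit 0); rewrite -/g !box_cap.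
  by rewrite -andbA.
have nij : i != j.
  apply/eqP => eij; have := sep i; rewrite i1 i2 {2}eij j3 !inE; move: i3.
  by rewrite inE => /negPf ->; rewrite andbF => /(_ erefl).
have nik : i != k.
  apply/eqP => eik; have := sep i; rewrite i1 i2 {2}eik k3 !inE; move: i3.
  by rewrite inE => /negPf ->; rewrite andbF => /(_ erefl).
have njk : j != k.
  apply/eqP => ejk; have := sep j; rewrite j1 j3 {2}ejk k2 !inE; move: j2.
  by rewrite inE => /negPf ->; rewrite andbF => /(_ erefl).
rewrite -add2n; apply: koszul_bound_set.
apply: (@nontrivial_class_triangle _ _ (box q1) (box q2) (box q3) _ _ g i j k);
  rewrite ?enum_uniq ?mem_enum ?inE //; try exact: box_down_closed; last 3 first.
- exact: box_add_distinct.
- exact: box_add_distinct.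
- exact: box_add_distinct.
- by move=> l; rewrite mem_enum inE; apply: sep.
- by move: i3; rewrite inE => /negPf ->; rewrite andbF.
- by move: j2; rewrite inE => /negPf ->; rewrite andbF.
- by move: k1; rewrite inE => /negPf ->.
Qed.

End DepthBounds.

(** * Partitions of boxes into cells *)

Section Partitions.
Variables (n d : nat).
Implicit Types (q lo hi : 'I_n -> option nat) (m : 'X_{1..n}) (i j k : 'I_n).
Implicit Types (P T : pred 'X_{1..n}) (E : {set 'I_n}).

Definition in_cell m (c : 'X_{1..n} * {set 'I_n}) :=
  [forall i, if i \in c.2 then (c.1 i <= m i)%N else m i == c.1 i].

(** Counting the cells that contain a monomial expresses at once that they are
    disjoint and that they cover P. *)
Definition cell_partition P := exists L : seq ('X_{1..n} * {set 'I_n}),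
  all (fun c : 'X_{1..n} * {set 'I_n} => d <= #|c.2|)%N L /\ forall m, count (in_cell m) L = P m.

Lemma eq_cell_partition P P' : P =1 P' -> cell_partition P -> cell_partition P'.
Proof. by move=> eP [L [dL defP]]; exists L; split=> // m; rewrite defP eP. Qed.

Lemma cell_partitionU P1 P2 P : (forall m, P m = (P1 m + P2 m)%N :> nat) ->
  cell_partition P1 -> cell_partition P2 -> cell_partition P.
Proof.
move=> eP [L1 [d1 def1]] [L2 [d2 def2]]; exists (L1 ++ L2).
by rewrite all_cat d1 d2; split=> // m; rewrite count_cat eP def1 def2.
Qed.

Definition slab (lo : 'I_n -> nat) hi m := [forall i, lo i <= m i]%N && box hi m.

(** One cell for each choice of the bounded exponents; the free ones start at
    lo. *)
Lemma slab_partition (lo : 'I_n -> nat) hi :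
  (d <= #|free_vars hi|)%N -> cell_partition (slab lo hi).
Proof.
move=> dhi; have [M hiM] := exists_bound hi.
pose N := (M + \max_i lo i)%N.
have loN i : (lo i <= N)%N by rewrite (leq_trans (leq_bigmax i)) ?leq_addl.
pose base (f : {ffun 'I_n -> 'I_N.+1}) : 'X_{1..n} := [multinom (f i : nat) | i < n].
pose ok (f : {ffun 'I_n -> 'I_N.+1}) := [forall i,
  if hi i is Some h then lo i <= f i < h else f i == lo i :> nat]%N.
exists [seq (base f, free_vars hi) | f <- enum {ffun 'I_n -> 'I_N.+1} & ok f].
split=> [|m]; first by apply/allP => c /mapP[f _ ->].
rewrite count_map count_filter.
have [/andP[/forallP lom /boxP him]|nm] := boolP (slab lo hi m); last first.
  rewrite (@eq_count _ _ pred0) ?count_pred0 // => f; apply/negP => /=.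
  case/andP=> /forallP fm /forallP okf; case/negP: nm.
  apply/andP; split; apply/forallP => i; move: (fm i) (okf i); rewrite inE mnmE /below;
    case: (hi i) => [h|] /=.
  - by move=> /eqP -> /andP[].
  - by move=> + /eqP <-.
  - by move=> /eqP -> /andP[].
  - by [].
pose f0 : {ffun 'I_n -> 'I_N.+1} := [ffun i => inord (if hi i is Some h then m i else lo i)].
have f0E i : f0 i = (if hi i is Some h then m i else lo i) :> nat.
  rewrite ffunE inordK // ltnS; move: (him i); case hii: (hi i) => [h|] //= mh.
  by have := hiM i h hii; rewrite /N; lia.
rewrite (@eq_count _ _ (pred1 f0)) => [|f].
  by rewrite count_uniq_mem ?enum_uniq // mem_enum.
apply/idP/eqP => [/andP[/forallP fm /forallP okf]|->].
  apply/ffunP => i; apply/val_inj; rewrite /= f0E; move: (fm i) (okf i); rewrite inE mnmE.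
  by case: (hi i) => [h|] /= => [/eqP ->|_ /eqP].
apply/andP; split; apply/forallP => i; rewrite ?inE ?mnmE f0E; move: (him i) (lom i);
  by case: (hi i) => [h|] //= -> ->.
Qed.

Definition exceeds q m i := if q i is Some h then (h <= m i)%N else false.

Lemma box_exceeds q m (s : seq 'I_n) : (forall i, i \in s) ->
  has (exceeds q m) s = ~~ box q m.
Proof.
move=> sT; rewrite negb_forall; apply/hasP/existsP => [[i _ qi]|[i qi]]; exists i => //;
  move: qi; rewrite /exceeds /below; case: (q i) => // h; by rewrite -leqNgt.
Qed.

(** The part of a slab where some bound of q is reached is split according to the
    first such coordinate i in the list s.  In the piece of i, the coordinates
    before i have received their bounds in q, i has only been bounded from below, and the
    coordinates after i are unchanged. *)
Lemma carve_partition T q (s : seq 'I_n) (lo : 'I_n -> nat) hi :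
  (forall s1 i s2 (lo' : 'I_n -> nat) hi', s = s1 ++ i :: s2 -> i \notin free_vars q ->
     free_vars hi' = [set j in free_vars hi | (j \notin s1) || (j \in free_vars q)] ->
     cell_partition (predI (slab lo' hi') T)) ->
  cell_partition (fun m => [&& slab lo hi m, has (exceeds q m) s & T m]).
Proof.
elim: s lo hi => [|i s IH] lo hi H.
  by exists [::]; split=> // m; rewrite /= andbF.
case qi: (q i) => [h|]; last first.
  apply: (@eq_cell_partition (fun m => [&& slab lo hi m, has (exceeds q m) s & T m])).
    by move=> m; rewrite /= {2}/exceeds qi.
  apply: IH => s1 k s2 lo' hi' es kq efree; apply: (H (i :: s1) k s2) => //.
    by rewrite es.
  rewrite efree; apply/setP => j; rewrite !inE negb_or.
  by have [->|] := eqVneq j i; rewrite ?qi ?orbT.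
(* Split at m_i = h: above it lies the piece of i, below it the recursion. *)
pose lo' j := if j == i then maxn (lo i) h else lo j.
pose hi' j := if j == i then Some (if hi i is Some h' then minn h h' else h) else hi j.
have slab_lo m : slab lo' hi m = slab lo hi m && (h <= m i)%N.
  apply/andP/andP => [[/forallP lom him]|[/andP[/forallP lom him] hm]].
    split; last by move: (lom i); rewrite /lo' eqxx geq_max => /andP[].
    apply/andP; split=> //; apply/forallP => j; move: (lom j); rewrite /lo'.
    by case: eqVneq => // ->; rewrite geq_max => /andP[].
  split=> //; apply/forallP => j; rewrite /lo'; case: eqVneq => // ->.
  by rewrite geq_max lom hm.
have slab_hi m : slab lo hi' m = slab lo hi m && ~~ (h <= m i)%N.
  rewrite /slab -andbA; congr andb; rewrite -ltnNge.
  apply/boxP/andP => [him|[/boxP him hm] j].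
    have := him i; rewrite /hi' eqxx => hmi; split.
      apply/boxP => j; have := him j; rewrite /hi'; case: eqVneq => // -> _.
      by move: hmi; case: (hi i) => //= h'; rewrite leq_min => /andP[].
    by move: hmi; case: (hi i) => //= h'; rewrite leq_min => /andP[].
  rewrite /hi'; case: eqVneq => [->|_]; last exact: him.
  move: (him i); case: (hi i) => //= h'.
  by rewrite leq_min hm.
apply: (@cell_partitionU (predI (slab lo' hi) T)
  (fun m => [&& slab lo hi' m, has (exceeds q m) s & T m])).
- move=> m; rewrite /= slab_lo slab_hi {1}/exceeds qi.
  by case: (slab lo hi m); case: (h <= m i)%N; case: (T m); case: (has _ _).
- apply: (H [::] i s) => //; first by rewrite inE qi.
  by apply/setP => j; rewrite !inE andbT.
apply: IH => s1 k s2 lo'' hi'' es kq efree; apply: (H (i :: s1) k s2) => //.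
  by rewrite es.
rewrite efree; apply/setP => j; rewrite !inE negb_or /hi'.
by have [->|ji] := eqVneq j i; rewrite ?qi ?andbF.
Qed.

(** The order is chosen so that little freedom is lost: the coordinates bounded in
    the slab come first, since bounding them again costs nothing, and those of E
    come last, so that a piece starting at a free coordinate outside E keeps the
    free coordinates of E.  The
    predicate T leaves room for the removal of a second box. *)
Lemma slab_diff_partition T q E (lo : 'I_n -> nat) hi :
  (forall (lo' : 'I_n -> nat) hi', free_vars hi' = free_vars hi ->
     cell_partition (predI (slab lo' hi') T)) ->
  (forall i (lo' : 'I_n -> nat) hi', i \in free_vars hi -> i \notin free_vars q ->
     i \in free_vars hi' ->
     free_vars hi :&: free_vars q \subset free_vars hi' ->
     (i \in E) || (free_vars hi :&: E \subset free_vars hi') ->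
     cell_partition (predI (slab lo' hi') T)) ->
  cell_partition (fun m => [&& slab lo hi m, ~~ box q m & T m]).
Proof.
move=> Hfull Hpart.
pose rank j : nat := if j \notin free_vars hi then 0 else if j \notin E then 1 else 2.
pose s := sort (relpre rank leq) (enum 'I_n).
have rank_trans : transitive (relpre rank leq) by move=> x y z; apply: leq_trans.
have s_sorted : pairwise (relpre rank leq) s.
  rewrite -sorted_pairwise //; apply: sort_sorted => x y; exact: leq_total.
have s_all j : j \in s by rewrite mem_sort mem_enum.
have s_uniq : uniq s by rewrite sort_uniq enum_uniq.
apply: (@eq_cell_partition (fun m => [&& slab lo hi m, has (exceeds q m) s & T m])).
  by move=> m; rewrite box_exceeds.
apply: carve_partition => s1 i s2 lo' hi' es iq efree.
have rank_le j : j \in s1 -> (rank j <= rank i)%N.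
  move: s_sorted; rewrite es pairwise_cat => /andP[/allrelP + _] js1.
  by apply=> //; rewrite inE eqxx.
have is1 : i \notin s1.
  by move: s_uniq; rewrite es cat_uniq /= negb_or => /and3P[_ /andP[]].
have [ihi|ihi] := boolP (i \in free_vars hi); last first.
  apply: Hfull; apply/setP => j; rewrite efree !inE.
  case: (boolP (j \in s1)) => [/rank_le|_]; last by rewrite andbT.
  by rewrite /rank ihi inE /=; case: (hi j == None) => //; case: ifP.
apply: (Hpart i) => //.
- by rewrite efree inE ihi is1.
- by apply/subsetP => j /setIP[jhi jq]; rewrite efree inE jhi jq orbT.
have [//|iE] := boolP (i \in E); apply/subsetP => j /setIP[jhi jE].
rewrite efree inE jhi /=; case: (boolP (j \in s1)) => // /rank_le.
by rewrite /rank ihi iE jhi jE.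
Qed.

Lemma slab_box_partition q (lo : 'I_n -> nat) hi :
  (d <= #|free_vars hi|)%N -> (d <= #|free_vars hi :&: free_vars q|.+1)%N ->
  cell_partition (predI (slab lo hi) (predC (box q))).
Proof.
move=> dhi dhiq.
apply: (@eq_cell_partition (fun m => [&& slab lo hi m, ~~ box q m & true])).
  by move=> m; rewrite andbT.
apply: (@slab_diff_partition predT q set0) => [lo' hi' efree|i lo' hi' ihi iq ihi' sub _];
  apply: (@eq_cell_partition (slab lo' hi')); try (by move=> m; rewrite /= andbT);
  apply: slab_partition; first by rewrite efree.
apply: leq_trans dhiq _.
have -> : (#|free_vars hi :&: free_vars q|.+1 = #|i |: free_vars hi :&: free_vars q|)%N.
  by rewrite cardsU1 inE (negPf iq) andbF.
by apply/subset_leq_card/subsetP => j /setU1P[->|/(subsetP sub)].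
Qed.

(** The slab minus q1 is carved with the free variables of q2 last, and q2 is then
    removed from every piece.  A piece starting at a variable i that is free in q2
    has gained i over the variables free in all three; a piece starting elsewhere
    has kept all the variables free in the slab and in q2. *)
Lemma slab_box_box_partition q1 q2 (lo : 'I_n -> nat) hi :
  (d <= #|free_vars hi|)%N -> (d <= #|free_vars hi :&: free_vars q1|.+1)%N ->
  (d <= #|free_vars hi :&: free_vars q2|.+1)%N ->
  (d <= #|free_vars hi :&: free_vars q1 :&: free_vars q2|.+2)%N ->
  cell_partition (fun m => [&& slab lo hi m, ~~ box q1 m & ~~ box q2 m]).
Proof.
move=> dhi d1 d2 d12.
apply: (@slab_diff_partition (predC (box q2)) q1 (free_vars q2)) =>
    [lo' hi' efree|i lo' hi' ihi i1 ihi' sub alt]; apply: slab_box_partition.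
- by rewrite efree.
- by rewrite efree.
- apply: leq_trans d1 _.
  have -> : (#|free_vars hi :&: free_vars q1|.+1 = #|i |: free_vars hi :&: free_vars q1|)%N.
    by rewrite cardsU1 inE (negPf i1) andbF.
  by apply/subset_leq_card/subsetP => j /setU1P[->|/(subsetP sub)].
have [i2|ni2] := boolP (i \in free_vars q2).
  apply: leq_trans d12 _; rewrite ltnS.
  have -> : (#|free_vars hi :&: free_vars q1 :&: free_vars q2|.+1 =
    #|i |: free_vars hi :&: free_vars q1 :&: free_vars q2|)%N.
    by rewrite [RHS]cardsU1 !in_setI (negPf i1) andbF.
  apply/subset_leq_card/subsetP => j /setU1P[->|]; first by rewrite inE ihi'.
  by case/setIP => /(subsetP sub) jhi' j2; rewrite inE jhi'.
apply: leq_trans d2 _; rewrite ltnS; move: alt; rewrite (negPf ni2) /= => /subsetP alt.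
apply/subset_leq_card/subsetP => j jI; rewrite inE alt //.
by case/setIP: jI.
Qed.

End Partitions.

(** * Unions of at most three boxes *)

Section UnionsOfBoxes.
Variables (K : fieldType) (n d : nat).
Implicit Types (Q : pred 'X_{1..n}) (q : 'I_n -> option nat).

Lemma box_partition q : (d <= #|free_vars q|)%N -> cell_partition d (box q).
Proof.
move=> dq; apply: eq_cell_partition (slab_partition (fun=> 0%N) dq) => m.
by rewrite /slab; case: forallP.
Qed.

Lemma box_diff_partition q1 q2 :
  (d <= #|free_vars q1|)%N -> (d <= #|free_vars q1 :&: free_vars q2|.+1)%N ->
  cell_partition d (predI (box q1) (predC (box q2))).
Proof.
move=> d1 d12; apply: eq_cell_partition (slab_box_partition (fun=> 0%N) d1 d12) => m.
by rewrite /= /slab; case: forallP.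
Qed.

Lemma union1_partition Q q : positive q -> Q =1 box q -> koszul_bound K d Q ->
  cell_partition d Q.
Proof.
move=> pq defQ dQ; apply: (@eq_cell_partition _ _ (box q)) => [m|]; first by rewrite defQ.
apply: box_partition; apply: (@koszul_bound_free _ _ _ _ dQ q pred0 0) => // m.
by rewrite defQ /= orbF.
Qed.

Lemma union2_partition Q q1 q2 : positive q1 -> positive q2 ->
  Q =1 predU (box q1) (box q2) -> koszul_bound K d Q -> cell_partition d Q.
Proof.
move=> p1 p2 defQ dQ.
have [/box_le_sub le12|n12] := boolP (box_le q1 q2).
  apply: (union1_partition p2 _ dQ) => m; rewrite defQ /=.
  by have := @le12 m; case: (box q1 m) => // ->.
have [/box_le_sub le21|n21] := boolP (box_le q2 q1).
  apply: (union1_partition p1 _ dQ) => m; rewrite defQ /= orbC.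
  by have := @le21 m; case: (box q2 m) => // ->.
have [M1 b1] := exists_bound q1; have [M2 b2] := exists_bound q2.
have d1 : (d <= #|free_vars q1|)%N.
  apply: (koszul_bound_free dQ p1 (@box_down_closed _ q2) defQ).
  by apply: contra n12; apply: corner_box b2.
have d2 : (d <= #|free_vars q2|)%N.
  apply: (koszul_bound_free dQ p2 (@box_down_closed _ q1) (M := M1)) => [m|].
    by rewrite defQ /= orbC.
  by apply: contra n21; apply: corner_box b1.
have d12 : (d <= #|free_vars q1 :&: free_vars q2|.+1)%N.
  apply: (koszul_bound_cap dQ (M := 0) p1 p2 (@box_down_closed _ q2) defQ) => // i iF.
  by rewrite -box_cap; apply: corner_exit.
apply: (@cell_partitionU _ _ (box q1) (predI (box q2) (predC (box q1)))).
- by move=> m; rewrite defQ /=; case: (box q1 m); case: (box q2 m).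
- exact: box_partition.
by apply: box_diff_partition => //; rewrite setIC.
Qed.

(** Since B_1 n B_2 lies in B_3, removing B_3 makes B_1 and B_2 disjoint, and in the
    complex at the corner of B_1 n B_3 the facet of B_2 can only be joined to that of
    B_3.  The bound on the free variables of q1 and q3 thus holds with B_2 u B_3
    as the second part. *)
Lemma union3_partition_middle Q q1 q2 q3 :
  positive q1 -> positive q2 -> positive q3 ->
  Q =1 predU (predU (box q1) (box q2)) (box q3) -> koszul_bound K d Q ->
  (d <= #|free_vars q1|)%N -> (d <= #|free_vars q2|)%N -> (d <= #|free_vars q3|)%N ->
  box_le (cap q1 q2) q3 -> cell_partition d Q.
Proof.
move=> p1 p2 p3 defQ dQ d1 d2 d3 /box_le_sub le12.
have {}le12 m : box q1 m -> box q2 m -> box q3 m.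
  by move=> b1 b2; apply: le12; rewrite box_cap b1.
have dU q q' : down_closed (predU (box q) (box q')).
  by move=> m m' /orP[] /box_down_closed /= ->; rewrite ?orbT.
have d13 : (d <= #|free_vars q1 :&: free_vars q3|.+1)%N.
  apply: (koszul_bound_cap dQ (M := 0) p1 p3 (dU q2 q3)) => // [m|m|i iF].
  - by rewrite defQ /= orbA.
  - by move=> /= ->; rewrite orbT.
  have := corner_exit 0 iF; rewrite box_cap; apply: contra.
  by move=> /andP[b1] /orP[b2|->]; rewrite b1 ?(le12 _ b1 b2).
have d23 : (d <= #|free_vars q2 :&: free_vars q3|.+1)%N.
  apply: (koszul_bound_cap dQ (M := 0) p2 p3 (dU q1 q3)) => // [m|m|i iF].
  - by rewrite defQ /= -orbA orbCA.
  - by move=> /= ->; rewrite orbT.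
  have := corner_exit 0 iF; rewrite box_cap; apply: contra.
  by move=> /andP[b2] /orP[b1|->]; rewrite b2 ?(le12 _ b1 b2).
apply: (@cell_partitionU _ _ (box q3)
  (predU (predI (box q1) (predC (box q3))) (predI (box q2) (predC (box q3))))).
- move=> m; rewrite defQ /=.
  by case: (box q1 m); case: (box q2 m); case: (box q3 m).
- exact: box_partition.
apply: (@cell_partitionU _ _ (predI (box q1) (predC (box q3)))
  (predI (box q2) (predC (box q3)))); try exact: box_diff_partition.
move=> m /=; have := @le12 m.
by case: (box q1 m); case: (box q2 m); case: (box q3 m) => // /(_ erefl erefl).
Qed.

(** Here no intersection of two boxes lies in the third, so the corner of such an
    intersection, taken far out in its free variables, is outside the third box and
    the pairwise bounds hold; the triangle gives the triple one. *)
Lemma union3_partition_triangle Q q1 q2 q3 :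
  positive q1 -> positive q2 -> positive q3 ->
  Q =1 predU (predU (box q1) (box q2)) (box q3) -> koszul_bound K d Q ->
  (d <= #|free_vars q1|)%N -> (d <= #|free_vars q2|)%N -> (d <= #|free_vars q3|)%N ->
  ~~ box_le (cap q1 q2) q3 -> ~~ box_le (cap q1 q3) q2 -> ~~ box_le (cap q2 q3) q1 ->
  cell_partition d Q.
Proof.
move=> p1 p2 p3 defQ dQ d1 d2 d3 n12 n13 n23.
have dU q q' : down_closed (predU (box q) (box q')).
  by move=> m m' /orP[] /box_down_closed /= ->; rewrite ?orbT.
have pair qa qb qc : positive qa -> positive qb -> positive qc ->
    Q =1 predU (box qa) (predU (box qb) (box qc)) -> ~~ box_le (cap qa qb) qc ->
    (d <= #|free_vars qa|)%N -> (d <= #|free_vars qb|)%N ->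
    (d <= #|free_vars qa :&: free_vars qb|.+1)%N.
  move=> pa pb pc defQ' nab da db; have [M bM] := exists_bound qc.
  apply: (koszul_bound_cap dQ (M := M) pa pb (dU qb qc) defQ') => // [m|i iF].
    by move=> /= ->.
  have := corner_exit M iF; rewrite box_cap /= => nb.
  apply/andP => -[ba /orP[bb|/box_down_closed bc]]; first by rewrite ba bb in nb.
  by move: nab; rewrite (corner_box (positive_cap pa pb) bM bc).
have d12 : (d <= #|free_vars q1 :&: free_vars q2|.+1)%N.
  by apply: (pair q1 q2 q3) => // m; rewrite defQ /= orbA.
have d13 : (d <= #|free_vars q1 :&: free_vars q3|.+1)%N.
  by apply: (pair q1 q3 q2) => // m; rewrite defQ /= -orbA [box q2 m || _]orbC.
have d23 : (d <= #|free_vars q2 :&: free_vars q3|.+1)%N.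
  by apply: (pair q2 q3 q1) => // m; rewrite defQ /= -orbA orbC -orbA.
have d123 := koszul_bound_triangle dQ p1 p2 p3 defQ n12 n13 n23.
apply: (@cell_partitionU _ _ (predU (box q1) (box q2))
  (fun m => [&& box q3 m, ~~ box q1 m & ~~ box q2 m])).
- by move=> m; rewrite defQ /=; case: (box q1 m); case: (box q2 m); case: (box q3 m).
- apply: (@cell_partitionU _ _ (box q1) (predI (box q2) (predC (box q1)))).
  + by move=> m /=; case: (box q1 m); case: (box q2 m).
  + exact: box_partition.
  by apply: box_diff_partition => //; rewrite setIC.
apply: (@eq_cell_partition _ _ (fun m =>
    [&& slab (fun=> 0%N) q3 m, ~~ box q1 m & ~~ box q2 m])) => [m|].
  by rewrite /slab; case: forallP.
apply: slab_box_box_partition => //; first by rewrite setIC.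
  by rewrite setIC.
by rewrite -setIA setIC.
Qed.

(** A box not contained in another has its corner outside both others, hence enough
    free variables; a contained box can be dropped. *)
Lemma union3_partition Q q1 q2 q3 : positive q1 -> positive q2 -> positive q3 ->
  Q =1 predU (predU (box q1) (box q2)) (box q3) -> koszul_bound K d Q ->
  cell_partition d Q.
Proof.
move=> p1 p2 p3 defQ dQ.
have irredundant qa qb qc : positive qa -> positive qb -> positive qc ->
    Q =1 predU (box qa) (predU (box qb) (box qc)) ->
    cell_partition d Q \/ (d <= #|free_vars qa|)%N.
  move=> pa pb pc defQ'.
  have [/box_le_sub le|nab] := boolP (box_le qa qb).
    left; apply: (union2_partition pb pc _ dQ) => m; rewrite defQ' /=.
    by have := @le m; case: (box qa m) => // ->.
  have [/box_le_sub le|nac] := boolP (box_le qa qc).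
    left; apply: (union2_partition pb pc _ dQ) => m; rewrite defQ' /=.
    by have := @le m; case: (box qa m) => // ->; rewrite ?orbT.
  have [Mb bb] := exists_bound qb; have [Mc bc] := exists_bound qc.
  right; apply: (koszul_bound_free dQ (M := Mb + Mc) pa _ defQ').
    by move=> m m' /orP[] /box_down_closed /= ->; rewrite ?orbT.
  apply/norP; split; [apply: contra nab | apply: contra nac]; apply: corner_box => //.
    by apply: bounded_byS bb; apply: leq_addr.
  by apply: bounded_byS bc; apply: leq_addl.
have [||||//|d1] := irredundant q1 q2 q3 => // [m|]; first by rewrite defQ /= orbA.
have [||||//|d2] := irredundant q2 q1 q3 => // [m|]; first by rewrite defQ /= -orbA orbCA.
have [||||//|d3] := irredundant q3 q1 q2 => // [m|]; first by rewrite defQ /= orbC.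
have [le12|n12] := boolP (box_le (cap q1 q2) q3).
  exact: (union3_partition_middle p1 p2 p3).
have [le13|n13] := boolP (box_le (cap q1 q3) q2).
  by apply: (union3_partition_middle p1 p3 p2) => // m; rewrite defQ /= orbAC.
have [le23|n23] := boolP (box_le (cap q2 q3) q1).
  by apply: (union3_partition_middle p2 p3 p1) => // m; rewrite defQ /= -orbA orbC.
exact: (union3_partition_triangle p1 p2 p3).
Qed.

End UnionsOfBoxes.

(** * From cells and Koszul classes to the quotient module *)

Section IdealTimesModule.
Variables (A : comNzRingType) (M : lmodType A).
Implicit Types (fs gs : seq A) (x y : M).

Lemma in_ideal_mul_nil x : in_ideal_mul [::] x <-> x = 0.
Proof.
split=> [[w ->]|->]; first by rewrite big_ord0.
by exists (fun=> 0); rewrite big_ord0.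
Qed.

Lemma in_ideal_mul_cons f fs x :
  in_ideal_mul (f :: fs) x <-> exists y, in_ideal_mul fs (x - f *: y).
Proof.
split=> [[w ->]|[y [w def_x]]].
  exists (w ord0); exists (fun i => w (lift ord0 i)).
  by rewrite big_ord_recl addrC addKr.
exists (fun i => if unlift ord0 i is Some j then w j else y).
rewrite big_ord_recl /= unlift_none -(subrK (f *: y) x) def_x addrC; congr (_ + _).
by apply: eq_bigr => i _; rewrite liftK.
Qed.

Lemma in_ideal_mul_cat fs gs x : in_ideal_mul (fs ++ gs) x <->
  exists2 y, in_ideal_mul fs y & in_ideal_mul gs (x - y).
Proof.
elim: fs x => [|f fs IH] x.
  split=> [gx|[y /in_ideal_mul_nil ->]]; last by rewrite subr0.
  by exists 0; rewrite ?subr0 //; apply/in_ideal_mul_nil.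
split=> [/in_ideal_mul_cons[z /IH[y fy gxy]]|[y /in_ideal_mul_cons[z fyz] gxy]].
  exists (f *: z + y); last by rewrite opprD addrA.
  by apply/in_ideal_mul_cons; exists z; rewrite addrC addrA addNr add0r.
apply/in_ideal_mul_cons; exists z; apply/IH; exists (y - f *: z) => //.
by rewrite opprB addrA subrK.
Qed.

Lemma in_ideal_mul_rcons fs f x :
  in_ideal_mul (rcons fs f) x <-> exists y, in_ideal_mul fs (x - f *: y).
Proof.
rewrite -cats1; split=> [/in_ideal_mul_cat[y fy /in_ideal_mul_cons[z /in_ideal_mul_nil]]|[z fz]].
  by move=> /eqP; rewrite subr_eq0 => /eqP e; exists z; rewrite -e subKr.
apply/in_ideal_mul_cat; exists (x - f *: z) => //.
apply/in_ideal_mul_cons; exists z; apply/in_ideal_mul_nil.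
by rewrite subKr subrr.
Qed.

Lemma in_ideal_mul0 fs : in_ideal_mul fs (0 : M).
Proof. by exists (fun=> 0); rewrite big1 // => i _; rewrite scaler0. Qed.

Lemma in_ideal_mulD fs x y :
  in_ideal_mul fs x -> in_ideal_mul fs y -> in_ideal_mul fs (x + y).
Proof.
move=> [v ->] [w ->]; exists (fun i => v i + w i).
by rewrite -big_split; apply: eq_bigr => i _; rewrite /= scalerDr.
Qed.

Lemma in_ideal_mulZ fs a x : in_ideal_mul fs x -> in_ideal_mul fs (a *: x).
Proof.
move=> [w ->]; exists (fun i => a *: w i); rewrite scaler_sumr.
by apply: eq_bigr => i _; rewrite !scalerA mulrC.
Qed.

Lemma mem_in_ideal_mul fs f x : f \in fs -> in_ideal_mul fs (f *: x).
Proof.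
elim: fs => // g fs IH; rewrite inE => /predU1P[->|/IH fx]; apply/in_ideal_mul_cons.
  by exists x; rewrite subrr; apply: in_ideal_mul0.
by exists 0; rewrite scaler0 subr0.
Qed.

Lemma sub_in_ideal_mul fs gs x :
  {subset fs <= gs} -> in_ideal_mul fs x -> in_ideal_mul gs x.
Proof.
move=> sub [w ->]; elim/big_ind: _ => [|y z|i _]; first exact: in_ideal_mul0.
  exact: in_ideal_mulD.
by apply/mem_in_ideal_mul/sub/mem_nth.
Qed.

End IdealTimesModule.

Lemma eq_nontrivial_class (A : comNzRingType) (N N' : A -> Prop) xs t :
  (forall p, N p <-> N' p) -> nontrivial_class N xs t -> nontrivial_class N' xs t.
Proof.
move=> NN' [c [Zc ct Bc]]; exists c; split=> // [s es|[b Bb]].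
  exact/NN'/Zc.
by apply: Bc; exists b => s es; apply/NN'/Bb.
Qed.

Lemma ex_is_max (P : nat -> Prop) d0 N :
  P d0 -> (forall e, P e -> (e <= N)%N) -> exists d, is_max P d.
Proof.
move=> Pd0 PN; apply: NNPP => nex.
have step k : exists2 e, P e & (k <= e)%N.
  elim: k => [|k [e Pe ke]]; first by exists d0.
  apply: NNPP => nek; apply: nex; exists e; split=> // e' Pe'.
  rewrite leqNgt; apply/negP => ee'; apply: nek; exists e' => //.
  exact: leq_ltn_trans ee'.
by have [e /PN eN] := step N.+1; rewrite ltnNge eN.
Qed.

Section MonomialQuotient.
Variables (K : fieldType) (n : nat) (I : idealr {mpoly K[n]}) (P : pred 'X_{1..n}).
Local Notation S := {mpoly K[n]}.
Local Notation R := ({ideal_quot I} : lmodType S).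
Local Notation piR := (\pi_{ideal_quot I}%qT : S -> {ideal_quot I}).

Hypothesis defI : forall p : S, p \in (I : pred S) <-> monomial_ideal P p.
Hypothesis dP : down_closed P.
Hypothesis P0 : P 0%MM.

Lemma pi_eq0 (p : S) : piR p = 0 <-> monomial_ideal P p.
Proof.
rewrite -defI -[in p \in _](subr0 p) Quotient.idealrBE -(rmorph0 piR).
by split=> [/eqP|/eqP].
Qed.

Lemma pi_scale (a p : S) : piR (a * p) = a *: (piR p : R).
Proof. exact: rmorphM. Qed.

Lemma pi_sub (p q : S) : piR (p - q) = (piR p : R) - piR q.
Proof. exact: rmorphB. Qed.

Lemma pi_surj (x : R) : exists p : S, x = piR p.
Proof. by exists (repr x); rewrite reprK. Qed.

(** The class is first extended to all the variables, and then loses one degree for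
    each element of the sequence; it cannot fall below degree 0. *)
Lemma regular_seq_koszul_bound (fs : seq S) :
  (forall f, f \in fs -> in_maxideal f) -> regular_seq R fs ->
  koszul_bound K (size fs) P.
Proof.
move=> fs_max [fs_reg _] vs t uvs ntc.
pose ws := enum (predC (mem vs)).
have uwv : uniq (ws ++ vs).
  rewrite cat_uniq enum_uniq uvs andbT /=; apply/hasPn => i iv.
  by rewrite mem_enum inE /= iv.
have sz : (size ws + size vs = n)%N.
  by rewrite -size_cat -(card_uniqP uwv) -[RHS]card_ord; apply: eq_card => i;
    rewrite mem_cat mem_enum !inE /=; case: (i \in vs).
have {}ntc := nontrivial_class_add_vars dP uwv ntc.
(* The preimage in S of the submodule spanned by the first k elements. *)
pose N k (p : S) := in_ideal_mul (take k fs) (piR p : R).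
have idN k : ideal_pred (N k).
  split=> [|u v|a u]; rewrite /N; first by rewrite rmorph0; apply: in_ideal_mul0.
    by rewrite rmorphD; apply: in_ideal_mulD.
  by rewrite pi_scale; apply: in_ideal_mulZ.
suff main k : (k <= size fs)%N -> (k <= size ws + t)%N /\
    nontrivial_class (N k) (vars K (ws ++ vs)) (size ws + t - k).
  by have [] := main _ (leqnn _); lia.
elim: k => [|k IH] ks.
  rewrite subn0; split=> //; apply: eq_nontrivial_class ntc => p.
  by rewrite /N take0 in_ideal_mul_nil pi_eq0.
have [kt ntk] := IH (ltnW ks).
have defN (p : S) : N k.+1 p <-> exists q : S, N k (p - fs`_k * q).
  rewrite /N (take_nth 0) // in_ideal_mul_rcons; split=> [[y]|[q]].
    by have [q ->] := pi_surj y => Nq; exists q; rewrite pi_sub pi_scale.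
  by rewrite pi_sub pi_scale; exists (piR q).
have fk : @in_ideal_mul S S^o (vars K (ws ++ vs)) fs`_k.
  apply: (@sub_in_ideal_mul S S^o) (fs_max _ (mem_nth 0 ks)) => _ /mapP[i _ ->].
  by apply: map_f; rewrite mem_cat mem_enum !inE /=; case: (i \in vs).
have regk (p : S) : N k (fs`_k * p) -> N k p.
  by rewrite /N pi_scale; apply: (fs_reg (Ordinal ks)).
have [] := nontrivial_class_regular (idN k) (idN k.+1) defN fk regk ntk.
by rewrite subn_gt0 subnS.
Qed.

Lemma in_cell_unique (L : seq ('X_{1..n} * {set 'I_n})) :
  (forall m, count (in_cell m) L = P m) ->
  forall m i j, in_cell m (tnth (in_tuple L) i) -> in_cell m (tnth (in_tuple L) j) -> i = j.
Proof.
move=> defP m i j ci cj; apply/eqP; apply: contraT => nij.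
have := defP m; rewrite -sum1_count (big_tnth _ _ L) sum1_card.
have : (#|[set i; j]| <= #|[pred k | in_cell m (tnth (in_tuple L) k)]|)%N.
  by apply/subset_leq_card/subsetP => k /set2P[] ->.
by rewrite cards2 nij => + e; rewrite e; case: (P m).
Qed.

Lemma cell_shift (b : 'X_{1..n}) (Z : {set 'I_n}) (u : 'X_{1..n}) :
  (forall k, k \notin Z -> u k = 0%N) -> in_cell (b + u)%MM (b, Z).
Proof.
move=> uZ; apply/forallP => k /=; rewrite mnmDE; case: ifP => kZ.
  exact: leq_addr.
by rewrite uZ ?kZ ?addn0.
Qed.

Section Decomposition.
Variables (d : nat) (L : seq ('X_{1..n} * {set 'I_n})).
Hypothesis dL : all (fun c : 'X_{1..n} * {set 'I_n} => d <= #|c.2|)%N L.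
Hypothesis defP : forall m, count (in_cell m) L = P m.
Local Notation cell := (tnth (in_tuple L)).
Let gen i : R := piR 'X_[(cell i).1].
Let cell_vars i := (cell i).2.

Lemma cell_sub m i : in_cell m (cell i) -> P m.
Proof.
move=> ci; have := defP m; case: (P m) => // /eqP; rewrite -leqn0 leqNgt -has_count.
by case/hasP; exists (cell i); rewrite ?mem_tnth.
Qed.

Lemma cell_exists m : P m -> exists i, in_cell m (cell i).
Proof.
move=> Pm; have : has (in_cell m) L by rewrite has_count defP Pm.
by case/hasP => c /(tnthP (in_tuple L))[i ->] ci; exists i.
Qed.

Lemma mcoeff_shift i (f : S) u : mpoly_in (cell_vars i) f -> f@_u != 0 ->
  in_cell ((cell i).1 + u)%MM (cell i).
Proof.
move=> fZ fu; rewrite [X in in_cell _ X]surjective_pairing; apply: cell_shift => k kZ.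
by apply: (fZ u) => //; rewrite mcoeff_msupp.
Qed.

Lemma gen_stanley_space i : stanley_space (quot_comp (I := I)) (gen i) (cell_vars i).
Proof.
split.
  exists [ffun k => ((cell i).1 k)%:Z]; exists 'X_[(cell i).1] => // m.
  by rewrite msuppX inE => /eqP ->.
move=> f fZ; rewrite -pi_scale pi_eq0 => fI; apply/mpolyP => u; rewrite mcoeff0.
apply/eqP; apply: contraT => fu.
have := fI _ (cell_sub (mcoeff_shift fZ fu)); rewrite mcoeffMX => fu0.
by rewrite fu0 eqxx in fu.
Qed.

Lemma gen_sum (x : R) : exists2 y : 'I_(size L) -> R,
  forall i, in_span (gen i) (cell_vars i) (y i) & x = \sum_i y i.
Proof.
have [p ->] := pi_surj x.
exists (fun i => piR (mrestrict (fun m => in_cell m (cell i)) p)) => [i|].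
  exists (\sum_(m <- msupp p | in_cell m (cell i)) p@_m *: 'X_[m - (cell i).1]).
    move=> m /msupp_sum_le /flatten_mapP[m']; rewrite mem_filter => /andP[cm' _].
    move=> /msuppZ_le; rewrite msuppX inE => /eqP -> k kZ.
    have := forallP cm' k; rewrite (negPf kZ) mnmBE => /eqP ->; exact: subnn.
  rewrite -pi_scale; congr piR; rewrite mulr_suml; apply: eq_bigr => m cm.
  rewrite -scalerAl -mpolyXD submK //; apply/mnm_lepP => k.
  by have := forallP cm k; case: ifP => // _ /eqP ->.
rewrite -rmorph_sum; apply/eqP; rewrite -subr_eq0 -rmorphB; apply/eqP/pi_eq0 => m Pm.
have [i ci] := cell_exists Pm.
rewrite mcoeffB raddf_sum /= (bigD1 i) //= mcoeff_mrestrict ci big1 ?addr0 ?subrr // => j nji.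
rewrite mcoeff_mrestrict; case: ifP => // cj.
by rewrite (in_cell_unique defP cj ci) eqxx in nji.
Qed.

Lemma gen_direct (y : 'I_(size L) -> R) :
  (forall i, in_span (gen i) (cell_vars i) (y i)) -> \sum_i y i = 0 -> forall i, y i = 0.
Proof.
move=> /fin_all_exists2[f fZ def_y] sum0 i; rewrite def_y.
suff -> : f i = 0 by rewrite scale0r.
apply/mpolyP => u; rewrite mcoeff0; apply/eqP; apply: contraT => fu.
have ci := mcoeff_shift (fZ i) fu.
have : piR (\sum_j f j * 'X_[(cell j).1]) = 0.
  by rewrite rmorph_sum -[RHS]sum0; apply: eq_bigr => j _; rewrite def_y -pi_scale.
move=> /pi_eq0 /(_ _ (cell_sub ci)); rewrite raddf_sum /= (bigD1 i) //= mcoeffMX.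
rewrite big1 ?addr0 => [fu0|j nji]; first by rewrite fu0 eqxx in fu.
apply/eqP; rewrite mcoeff_eq0; apply: contra nji => /msuppM_le /allpairsP[[u' b]] /=.
rewrite msuppX inE => -[fu' /eqP -> eu].
apply/eqP; apply: (in_cell_unique defP _ ci); rewrite eu addmC.
by apply: mcoeff_shift (fZ j) _; rewrite -mcoeff_msupp.
Qed.

Definition cell_decomposition : stanley_decomposition (quot_comp (I := I)) :=
  StanleyDecomposition gen_stanley_space gen_sum gen_direct.

Lemma sdepth_cell_decomposition : (d <= n)%N -> (d <= sdepth_of cell_decomposition)%N.
Proof.
move=> dn; rewrite /sdepth_of; elim/big_ind: _ => // [x y dx dy|i _].
  by rewrite leq_min dx.
exact: (allP dL _ (mem_tnth i (in_tuple L))).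
Qed.

End Decomposition.

(** A maximal regular sequence provides the Koszul bounds for d, its length, and a
    partition for this d gives the Stanley decomposition.  Both maxima exist, as
    both sets of values are non-empty and bounded by n. *)
Lemma stanley_inequality_of_partition :
  (forall d, koszul_bound K d P -> cell_partition d P) ->
  exists s d : nat,
    [/\ is_sdepth (M := R) (quot_comp (I := I)) s, is_depth R d & (s >= d)%N].
Proof.
move=> partP.
have bound_n d : koszul_bound K d P -> (d <= n)%N.
  move=> dP'; have /(dP' [::] 0 erefl) : nontrivial_class (monomial_ideal (K := K) P) [::] 0.
    exact: (@nontrivial_class_socle K n P [::] 0%MM).
  by rewrite addn0.
have [d [[fs [fs_max fs_reg <-]] dmax]] : exists d, is_depth R d.
  apply: (@ex_is_max _ 0 n) => [|e [fs [fs_max fs_reg <-]]].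
    exists [::]; split=> //; split=> [[]//|].
    exists (piR 1) => /in_ideal_mul_nil /pi_eq0 /(_ _ P0) /eqP.
    by rewrite mcoeff1 eqxx oner_eq0.
  exact/bound_n/regular_seq_koszul_bound.
have kb := regular_seq_koszul_bound fs_max fs_reg.
have [L [dL defP]] := partP _ kb.
have dD := sdepth_cell_decomposition dL defP (bound_n _ kb).
have [s [Ds smax]] : exists s, is_sdepth (M := R) (quot_comp (I := I)) s.
  apply: (@ex_is_max _ _ n) => [|_ [D <-]]; first by exists (cell_decomposition defP).
  rewrite /sdepth_of; elim/big_ind: _ => // [x y xn _|i _].
    by rewrite geq_min xn.
  by rewrite -[X in (_ <= X)%N]card_ord max_card.
exists s, (size fs); split=> //; first by split=> //; exists fs.
by apply: leq_trans dD (smax _ _); exists (cell_decomposition defP).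
Qed.

End MonomialQuotient.

(** A polynomial is in a monomial ideal when all its monomials are divisible by
    generators. *)
Lemma irreducible_ideal_box (K : fieldType) (n : nat) (Q : idealr {mpoly K[n]}) :
  irreducible_monomial_ideal Q -> exists2 q : 'I_n -> option nat, positive q &
    forall p : {mpoly K[n]}, p \in (Q : pred _) <-> monomial_ideal (box q) p.
Proof.
move=> [A [a [a_gt0 defQ]]].
exists (fun i => if i \in A then Some (a i) else None) => [i|p].
  by case: ifP => // /a_gt0; case: (a i).
set q := fun i => _; rewrite defQ; split.
  have [N0 ND NM] := monomial_idealP K (@box_down_closed _ q).
  case=> w ->; elim/big_ind: _ => // j _.
  have /mapP[i iA ->] := mem_nth 0 (ltn_ord j).
  rewrite [_ *: _]mulrC; apply: NM; rewrite mpolyXn; apply: monomial_idealX.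
  rewrite mem_enum in iA; apply/boxP => /(_ i).
  by rewrite /q iA /= mulmnE mnm1E eqxx mul1n ltnn.
move=> pQ; rewrite [p]mpolyE big_seq; elim/big_ind: _ => [|u v|m mp].
- exact: (@in_ideal_mul0 _ {mpoly K[n]}^o).
- exact: (@in_ideal_mulD _ {mpoly K[n]}^o).
have /forallPn[i] : ~~ box q m.
  by apply/negP => /pQ pm; rewrite mcoeff_msupp pm eqxx in mp.
rewrite /q; case: ifP => //= iA; rewrite -leqNgt => am.
have -> : m = (U_(i) *+ a i + (m - U_(i) *+ a i))%MM.
  rewrite addmC submK //; apply/mnm_lepP => j; rewrite mulmnE mnm1E.
  by have [<-|_] := eqVneq i j; rewrite ?mul1n // mul0n.
rewrite mpolyXD -mpolyXn scalerAr.
by apply: (@mem_in_ideal_mul _ {mpoly K[n]}^o); apply: map_f; rewrite mem_enum.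
Qed.

Theorem theorem5p9 (K : fieldType) (n : nat) (Q1 Q2 Q3 : idealr {mpoly K[n]})
  (irr1 : irreducible_monomial_ideal Q1) (nz1 : nonzero_ideal Q1)
  (irr2 : irreducible_monomial_ideal Q2) (nz2 : nonzero_ideal Q2)
  (irr3 : irreducible_monomial_ideal Q3) (nz3 : nonzero_ideal Q3) :
  let I : idealr {mpoly K[n]} := idealI (idealI Q1 Q2) Q3 in
  let R : lmodType {mpoly K[n]} := {ideal_quot I} in
  exists s d : nat,
    [/\ is_sdepth (M := R) (quot_comp (I := I)) s, is_depth R d & (s >= d)%N].
Proof.
move=> I R.
have [q1 p1 def1] := irreducible_ideal_box irr1.
have [q2 p2 def2] := irreducible_ideal_box irr2.
have [q3 p3 def3] := irreducible_ideal_box irr3.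
apply: (@stanley_inequality_of_partition K n I (predU (predU (box q1) (box q2)) (box q3))).
- move=> p; rewrite !inE; split.
    move=> /andP[/andP[/def1 P1 /def2 P2] /def3 P3] m.
    by case/orP => [/orP[]|]; [apply: P1 | apply: P2 | apply: P3].
  move=> Ip; apply/andP; split; first (apply/andP; split);
    [apply/def1 | apply/def2 | apply/def3] => m bm; apply: Ip; by rewrite /= bm ?orbT.
- by move=> m m' /orP[/orP[]|] /box_down_closed /= ->; rewrite ?orbT.
- rewrite /= (_ : box q1 0%MM) //; apply/boxP => i; rewrite mnm0E.
  by have := p1 i; case: (q1 i) => [[]|].
by move=> d; apply: (union3_partition p1 p2 p3).
Qed.
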